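(* Let $(V,\mu)$ be a separable probability space and let $G$ be a group of unitary operators on $L_2(V,\mu)$ that acts weakly random. Let $0<d<\infty$ and let $\mathcal{I}(G,d)$ denote the set of self-adjoint integral kernel operators $M:V\times V\to\mathbb{C}$ that are invariant under $G$ and satisfy $\|M\|_\infty\le d$. Then weak convergence on $\mathcal{I}(G,d)$ coincides with convergence in the cut norm. In particular $\mathcal{I}(G,d)$ is compact in the cut norm.
   Context: A kernel operator is a complex-valued function $M\in L_2(V\times V,\mu\times\mu)$ (up to a.e. equality), acting on $L_2(V,\mu)$ by $(Mf)(x)=\int M(x,y)f(y)\,d\mu(y)$; it is self-adjoint if $M(x,y)=\overline{M(y,x)}$ a.e. $\|M\|_\infty$ is the $L_\infty$ norm of $M$ on $V\times V$. The cut norm is $\|M\|_\square=\sup|f^*Mg|$, the supremum over measurable $f,g:V\to\mathbb{C}$ with $\|f\|_\infty,\|g\|_\infty\le 1$, where $f^*Mg=\iint\overline{f(x)}M(x,y)g(y)\,d\mu(x)\,d\mu(y)$. Weak convergence means weak convergence in the Hilbert space $L_2(V\times V)$. A unitary operator $\alpha$ acts on kernel operators by $M^\alpha=\alpha M\alpha^{-1}$; $M$ is $G$-invariant if $M^\alpha=M$ for all $\alpha\in G$. A group $G$ of unitary operators on $L_2(V)$ acts weakly random if for every natural number $n$ the linear span of all $G$-invariant subspaces of $L_2(V)$ of dimension at most $n$ is finite dimensional. *)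

(* Defs.v *)
From HB Require Import structures.
From mathcomp Require Import all_boot all_order all_algebra.
From mathcomp Require Import generic_quotient ring_quotient.
From mathcomp Require Import all_classical all_reals all_analysis.
From mathcomp Require Import measurable_realfun ess_sup_inf.
From mathcomp Require Import complex ring lra.

Set Implicit Arguments.
Unset Strict Implicit.
Unset Printing Implicit Defensive.

Import Order.TTheory GRing.Theory Num.Theory.
Import numFieldNormedType.Exports.
Import complex Normc.

Local Open Scope classical_set_scope.
Local Open Scope ring_scope.
Local Open Scope complex_scope.

Section ComplexFunctions.
Context {d : measure_display} {T : measurableType d} {R : realType}.
Variable mu : {measure set T -> \bar R}.

(* R[i] carries no sigma-algebra in the library; its Borel sigma-algebra is the
   product one, so measurability is that of both components. *)
Definition cmeasurable (f : T -> R[i]) : Prop :=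
  measurable_fun setT (fun x => Re (f x)) /\
  measurable_fun setT (fun x => Im (f x)).

Definition cintegral (f : T -> R[i]) : R[i] :=
  (\int[mu]_x Re (f x)) +i* (\int[mu]_x Im (f x)).

Definition cLnorm (p : \bar R) (f : T -> R[i]) : \bar R :=
  ('N[mu]_p[EFin \o (fun x => normc (f x))])%E.

(* Square-integrable functions: no quotient yet. *)
Definition L2pred : {pred T -> R[i]} :=
  mem [set f | cmeasurable f /\ (cLnorm 2%:E f < +oo)%E].

Lemma measurable_normc f : cmeasurable f ->
  measurable_fun setT (fun x => normc (f x)).
Proof.
move=> [mr mi].
rewrite [X in measurable_fun _ X](_ : _ = @Num.sqrt R \o
   (fun x => Re (f x) ^+ 2 + Im (f x) ^+ 2)); last first.
  by apply/funext => x /=; case: (f x).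
apply: (@measurableT_comp _ _ _ _ _ _ (@Num.sqrt R)).
  by apply: continuous_measurable_fun; exact: sqrt_continuous.
by apply: measurable_funD; apply: measurable_funX.
Qed.

Lemma cmeasurableD f g : cmeasurable f -> cmeasurable g -> cmeasurable (f + g).
Proof.
move=> [fr fi] [gr gi]; split.
  rewrite [X in measurable_fun _ X](_ : _ =
    (fun x => Re (f x) + Re (g x))); first exact: measurable_funD.
  by apply/funext => x /=; rewrite !fctE; case: (f x); case: (g x).
rewrite [X in measurable_fun _ X](_ : _ =
  (fun x => Im (f x) + Im (g x))); first exact: measurable_funD.
by apply/funext => x /=; rewrite !fctE; case: (f x); case: (g x).
Qed.

Lemma cmeasurableM f g : cmeasurable f -> cmeasurable g ->
  cmeasurable (fun x => f x * g x).
Proof.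
move=> [fr fi] [gr gi]; split.
  rewrite [X in measurable_fun _ X](_ : _ =
    (fun x => Re (f x) * Re (g x) - Im (f x) * Im (g x))).
    by apply: measurable_funB; apply: measurable_funM.
  by apply/funext => x /=; case: (f x); case: (g x).
rewrite [X in measurable_fun _ X](_ : _ =
  (fun x => Re (f x) * Im (g x) + Im (f x) * Re (g x))).
  by apply: measurable_funD; apply: measurable_funM.
by apply/funext => x /=; case: (f x); case: (g x).
Qed.

Lemma cmeasurable_cst c : cmeasurable (fun=> c).
Proof. by split; exact: measurable_cst. Qed.

Lemma cmeasurable_conj f : cmeasurable f -> cmeasurable (fun x => (f x)^*).
Proof.
move=> [fr fi]; split.
  rewrite [X in measurable_fun _ X](_ : _ = (fun x => Re (f x)))//.
  by apply/funext => x /=; case: (f x).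
rewrite [X in measurable_fun _ X](_ : _ = (fun x => - Im (f x))).
  exact: measurable_funN.
by apply/funext => x /=; case: (f x).
Qed.

Lemma normc_ge0 (z : R[i]) : 0 <= normc z.
Proof. by case: z => a b; exact: sqrtr_ge0. Qed.

Lemma L2pred_intP f : f \in L2pred <->
  cmeasurable f /\ (\int[mu]_x ((normc (f x)) ^+ 2)%:E < +oo)%E.
Proof.
have E : cLnorm 2%:E f =
   ((\int[mu]_x ((normc (f x)) ^+ 2)%:E) `^ (2^-1))%E.
  rewrite /cLnorm unlock /=; congr (_ `^ _)%E; apply: eq_integral => x _ /=.
  by rewrite ger0_norm ?normc_ge0// powR_mulrn ?normc_ge0.
split.
  rewrite inE => -[mf]; rewrite E => h; split => //.
  by apply: lty_poweRy h; rewrite invr_neq0.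
move=> [mf h]; rewrite inE; split => //; rewrite E.
by apply: poweR_lty.
Qed.

Lemma L2pred_submod : submod_closed L2pred.
Proof.
split.
  apply/L2pred_intP; split; first exact: cmeasurable_cst.
  rewrite integral0_eq ?ltry// => x _; rewrite (_ : (0 : T -> R[i]) x = 0)//.
  by rewrite normc0 expr0n.
move=> a f g /L2pred_intP[mf lf] /L2pred_intP[mg lg].
apply/L2pred_intP; split.
  by apply: cmeasurableD => //; apply: cmeasurableM mf; exact: cmeasurable_cst.
have mN h : cmeasurable h ->
    measurable_fun setT (fun x => ((normc (h x)) ^+ 2)%:E).
  by move=> mh; apply/measurable_EFinP/measurable_funX/measurable_normc.
have p2 (x : R) : (0 <= (x ^+ 2)%:E)%E by rewrite lee_fin sqr_ge0.
have mcst (c : R) : (0 <= c) -> (0 <= c%:E)%E by rewrite lee_fin.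
pose c := 2 * normc a ^+ 2.
have c0 : 0 <= c by rewrite mulr_ge0// sqr_ge0.
apply: (@le_lt_trans _ _ (\int[mu]_x (c%:E * ((normc (f x)) ^+ 2)%:E +
  2%:E * ((normc (g x)) ^+ 2)%:E))%E).
  apply: ge0_le_integral => //.
  - by apply: mN; apply: cmeasurableD => //; apply: cmeasurableM mf;
      exact: cmeasurable_cst.
  - by apply: emeasurable_funD; apply: measurable_funeM; exact: mN.
  - move=> x _; rewrite -!EFinM -EFinD lee_fin !fctE.
    apply: (@le_trans _ _ ((normc (a * f x) + normc (g x)) ^+ 2)).
      by rewrite ler_sqr ?nnegrE ?addr_ge0 ?normc_ge0// le_normcD.
    rewrite normcM /c; set u := normc a * normc (f x); set v := normc (g x).
    rewrite -subr_ge0 (_ : _ - _ = (u - v) ^+ 2) ?sqr_ge0// /u; ring.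
rewrite ge0_integralD//; last 4 first.
- by move=> x _; rewrite mule_ge0// mcst.
- by apply: measurable_funeM; exact: mN.
- by move=> x _; rewrite mule_ge0// mcst.
- by apply: measurable_funeM; exact: mN.
rewrite !ge0_integralZl//; [|exact: mN|exact: mN].
by rewrite lte_add_pinfty// lte_mul_pinfty// ?mcst.
Qed.

HB.instance Definition _ := GRing.isSubmodClosed.Build R[i] (T -> R[i]) L2pred
  L2pred_submod.

Record L2fun : Type := MkL2fun { L2fun_val :> T -> R[i];
                                 L2fun_valP : L2fun_val \in L2pred }.
HB.instance Definition _ := [isSub for L2fun_val].
HB.instance Definition _ := [Choice of L2fun by <:].
HB.instance Definition _ := [SubChoice_isSubLmodule of L2fun by <:].

Definition ae0 : {pred L2fun} := mem [set f : L2fun | {ae mu, forall x, f x = 0}].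

Lemma ae0_zmod : zmod_closed ae0.
Proof.
split; first by rewrite inE; exact: nearW.
move=> f g; rewrite !inE => f0 g0; near=> x.
suff : (f - g) x = f x - g x by move=> ->; rewrite (near f0)// (near g0)// subrr.
by [].
Unshelve. all: by end_near. Qed.

HB.instance Definition _ := GRing.isZmodClosed.Build L2fun ae0 ae0_zmod.

End ComplexFunctions.

Local Open Scope quotient_scope.

Section L2Space.
Context {d : measure_display} {T : measurableType d} {R : realType}.
Variable mu : {measure set T -> \bar R}.

(* The Hilbert space L_2(mu): square-integrable functions modulo a.e. equality.
   Elements coerce to a chosen representative. *)
Definition L2 : Type := Quotient.quot (@ae0 d T R mu).
HB.instance Definition _ := EqQuotient.on L2.
HB.instance Definition _ := Choice.on L2.
HB.instance Definition _ := GRing.Zmodule.on L2.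

Definition L2repr (u : L2) : T -> R[i] := repr u : L2fun mu.
Coercion L2repr : L2 >-> Funclass.

Definition L2class (f : L2fun mu) : L2 := \pi_L2 f.

Lemma L2classP (f g : L2fun mu) :
  L2class f = L2class g <-> {ae mu, forall x, f x = g x}.
Proof.
have E : (L2class f == L2class g) = ((f - g) \in @ae0 d T R mu).
  by rewrite Quotient.idealrBE.
rewrite (rwP eqP) E inE; split; apply: filterS => x.
  by move=> /eqP; rewrite subr_eq0 => /eqP.
by move=> fg; apply/eqP; rewrite subr_eq0; apply/eqP.
Qed.

Lemma L2reprK (f : L2fun mu) : {ae mu, forall x, L2class f x = f x}.
Proof. by apply/L2classP; rewrite /L2class reprK. Qed.

Lemma L2classK (u : L2) : L2class (repr u) = u.
Proof. exact: reprK. Qed.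

Lemma L2classD (f g : L2fun mu) : L2class (f + g) = L2class f + L2class g.
Proof. exact: Quotient.pi_add. Qed.

Definition L2scale (a : R[i]) (u : L2) : L2 := L2class (a *: (repr u : L2fun mu)).

Lemma L2scale_class a (f : L2fun mu) : L2scale a (L2class f) = L2class (a *: f).
Proof.
apply/L2classP; have := L2reprK f; apply: filterS => x fx.
by rewrite [LHS](_ : _ = a * L2class f x)// fx.
Qed.

Let L2scaleA a b v : L2scale a (L2scale b v) = L2scale (a * b) v.
Proof. by rewrite -[v]L2classK !L2scale_class scalerA. Qed.
Let L2scale1 : left_id 1 L2scale.
Proof. by move=> v; rewrite -[v]L2classK L2scale_class scale1r. Qed.
Let L2scaleDr : right_distributive L2scale +%R.
Proof.
move=> a u v; rewrite -[u]L2classK -[v]L2classK.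
by rewrite -L2classD !L2scale_class scalerDr L2classD.
Qed.
Let L2scaleDl v : {morph L2scale^~ v : a b / a + b}.
Proof.
by move=> a b; rewrite -[v]L2classK !L2scale_class scalerDl L2classD.
Qed.

HB.instance Definition _ := GRing.Zmodule_isLmodule.Build R[i] L2
  L2scaleA L2scale1 L2scaleDr L2scaleDl.

Lemma L2_ext (u v : L2) : {ae mu, forall x, u x = v x} -> u = v.
Proof. by move=> uv; rewrite -[u]L2classK -[v]L2classK; exact/L2classP. Qed.

Lemma L2reprD (u v : L2) : {ae mu, forall x, L2repr (u + v) x = u x + v x}.
Proof.
have := L2reprK ((repr u : L2fun mu) + (repr v : L2fun mu)).
by apply: filterS => x; rewrite L2classD !L2classK.
Qed.

Lemma L2reprZ a (u : L2) : {ae mu, forall x, L2repr (a *: u) x = a * u x}.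
Proof. exact: L2reprK. Qed.

(* Antilinear in the first argument. *)
Definition inner (u v : L2) : R[i] := cintegral mu (fun x => (u x)^* * v x).

(* Weak convergence of an arbitrary filter; for a sequence take F := u @ \oo. By
   the Riesz representation theorem the functionals [inner w] exhaust the dual. *)
Definition weak_cvg (F : set_system L2) (u : L2) : Prop :=
  forall w : L2, (inner w v : R[i]^o) @[v --> F] --> (inner w u : R[i]^o).

End L2Space.

Section Operators.
Context {K : fieldType} {H : lmodType K}.

Definition span (A : set H) : set H :=
  [set v | exists n (a : 'I_n -> K) (x : 'I_n -> H),
     (forall i, A (x i)) /\ v = \sum_i a i *: x i].

(* S is a subspace of dimension at most n, i.e. spanned by n vectors. *)
Definition dim_le (n : nat) (S : set H) : Prop :=
  exists x : 'I_n -> H, S = span (range x).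

Definition finite_dim (S : set H) : Prop := exists n, dim_le n S.

Definition invariant_subspace (G : set (H -> H)) (S : set H) : Prop :=
  forall a, G a -> a @` S `<=` S.

Definition acts_weakly_random (G : set (H -> H)) : Prop :=
  forall n, finite_dim
    (span (\bigcup_(S in [set S | dim_le n S /\ invariant_subspace G S]) S)).

End Operators.

Section CIntegrable.
Context {d : measure_display} {T : measurableType d} {R : realType}.
Variable mu : {measure set T -> \bar R}.

Definition cintegrable (f : T -> R[i]) : Prop :=
  mu.-integrable setT (fun x => (Re (f x))%:E) /\
  mu.-integrable setT (fun x => (Im (f x))%:E).

Lemma cintegralZD a f g : cintegrable f -> cintegrable g ->
  cintegral mu (fun x => a * f x + g x) = a * cintegral mu f + cintegral mu g.
Proof.
move=> [fr fi] [gr gi]; case: a => a b; rewrite /cintegral.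
have iZ (c : R) h : mu.-integrable setT (fun x => (h x)%:E) ->
  mu.-integrable setT (fun x => (c * h x)%:E).
  by move=> ih; under eq_fun do rewrite EFinM; exact: integrableZl.
have iD h k : mu.-integrable setT (fun x => (h x)%:E) ->
   mu.-integrable setT (fun x => (k x)%:E) ->
   mu.-integrable setT (fun x => (h x + k x)%:E).
  by move=> ih ik; under eq_fun do rewrite EFinD; exact: integrableD.
rewrite [X in X +i* _](_ : _ = \int[mu]_x ((a * Re (f x) + (- b) * Im (f x)) + Re (g x))); last first.
  by apply: eq_Rintegral => x _; case: (f x); case: (g x) => /= *; rewrite mulNr.
rewrite [X in _ +i* X](_ : _ = \int[mu]_x ((a * Im (f x) + b * Re (f x)) + Im (g x))); last first.
  by apply: eq_Rintegral => x _; case: (f x); case: (g x) => /= *.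
rewrite !RintegralD//; try by [apply: iZ|apply: iD => //; apply: iZ].
by rewrite !RintegralZl// mulNr.
Qed.

Lemma normc_ge_ReIm (z : R[i]) : `|Re z| <= normc z /\ `|Im z| <= normc z.
Proof.
case: z => x y /=; split; rewrite -sqrtr_sqr ler_wsqrtr//.
  by rewrite lerDl sqr_ge0.
by rewrite lerDr sqr_ge0.
Qed.

Lemma cintegrable_dom f (g : T -> R) : cmeasurable f ->
  mu.-integrable setT (EFin \o g) ->
  {ae mu, forall x, normc (f x) <= g x} -> cintegrable f.
Proof.
move=> [fr fi] ig le.
suff H (h : T -> R) : measurable_fun setT h ->
    (forall x, `|h x| <= normc (f x)) -> mu.-integrable setT (fun x => (h x)%:E).
  by split; apply: H => // x; have [] := normc_ge_ReIm (f x).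
move=> mh hle; apply/integrableP; split; first exact/measurable_EFinP.
move/integrableP : ig => [mg]; apply: le_lt_trans.
apply: ae_ge0_le_integral => //.
- by apply: measurableT_comp => //; exact/measurable_EFinP.
- by apply: measurableT_comp.
- apply: filterS le => x le _ /=; rewrite lee_fin.
  exact: (le_trans (hle x)) (le_trans le (ler_norm _)).
Qed.

Lemma eq_ae_cintegral f g : cmeasurable f -> cmeasurable g ->
  {ae mu, forall x, f x = g x} -> cintegral mu f = cintegral mu g.
Proof.
move=> [fr fi] [gr gi] fg; rewrite /cintegral /Rintegral.
congr (_ +i* _); congr fine; apply: ae_eq_integral => //;
  try (by apply/measurable_EFinP);
  by apply: filterS fg => x -> _.
Qed.

Lemma L2_cmeasurable (u : L2 mu) : cmeasurable u.
Proof.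
by have /L2pred_intP[] := L2fun_valP (repr u : L2fun mu).
Qed.

Lemma L2_sqr_lty (u : L2 mu) : (\int[mu]_x ((normc (u x)) ^+ 2)%:E < +oo)%E.
Proof.
by have /L2pred_intP[] := L2fun_valP (repr u : L2fun mu).
Qed.

End CIntegrable.

Section Kernels.
Context {d : measure_display} {V : measurableType d} {R : realType}.
Variable P : probability V R.

Definition L2kernel : Type := L2 (P \x P)%E.
HB.instance Definition _ := GRing.Lmodule.on L2kernel.

(* f^* M g *)
Definition cut_form (f : V -> R[i]) (M : L2kernel) (g : V -> R[i]) : R[i] :=
  cintegral (P \x P)%E (fun z => (f z.1)^* * L2repr M z * g z.2).

Definition Linf_ball : set (V -> R[i]) :=
  [set f | cmeasurable f /\ (cLnorm P +oo f <= 1)%E].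

Definition cut_norm (M : L2kernel) : \bar R :=
  ereal_sup [set (normc (cut_form f.1 M f.2))%:E | f in Linf_ball `*` Linf_ball].

Lemma Linf_ball_ae f : Linf_ball f -> {ae P, forall x, normc (f x) <= 1}.
Proof.
move=> [_]; rewrite /cLnorm unlock /= probability_setT lte01 => /ess_supP.
by apply: filterS => x /=; rewrite lee_fin ger0_norm// normc_ge0.
Qed.

Lemma ae_fst (Q : V -> Prop) : {ae P, forall x, Q x} ->
  {ae (P \x P)%E, forall z, Q z.1}.
Proof.
move=> [A [mA A0 sA]]; exists (A `*` setT); split.
- exact: measurableX.
- etransitivity; first exact: product_measure1E.
  by rewrite [X in (X * _)%E](_ : _ = 0%E) ?mul0e.
- by move=> z /= nQ; split => //; exact: sA.
Qed.

Lemma ae_snd (Q : V -> Prop) : {ae P, forall x, Q x} ->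
  {ae (P \x P)%E, forall z, Q z.2}.
Proof.
move=> [A [mA A0 sA]]; exists (setT `*` A); split.
- exact: measurableX.
- etransitivity; first exact: product_measure1E.
  by rewrite [X in (_ * X)%E](_ : _ = 0%E) ?mule0.
- by move=> z /= nQ; split => //; exact: sA.
Qed.

Lemma cut_integrand_measurable f (M : L2kernel) g :
  cmeasurable f -> cmeasurable g ->
  cmeasurable (fun z : V * V => (f z.1)^* * L2repr M z * g z.2).
Proof.
move=> [fr fi] [gr gi]; apply: cmeasurableM.
  apply: cmeasurableM; last exact: L2_cmeasurable.
  apply: cmeasurable_conj; split.
    exact: (measurableT_comp fr measurable_fst).
  exact: (measurableT_comp fi measurable_fst).
split; first exact: (measurableT_comp gr measurable_snd).
exact: (measurableT_comp gi measurable_snd).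
Qed.

Lemma cut_integrand_integrable f (M : L2kernel) g : Linf_ball f -> Linf_ball g ->
  cintegrable (P \x P)%E (fun z => (f z.1)^* * L2repr M z * g z.2).
Proof.
move=> bf bg.
apply: (@cintegrable_dom _ _ _ _ _ (fun z => 1 + normc (L2repr M z) ^+ 2)).
- by apply: cut_integrand_measurable; [case: bf|case: bg].
- apply/integrableP; split.
    apply/measurable_EFinP/measurable_funD => //.
    exact/measurable_funX/measurable_normc/L2_cmeasurable.
  under eq_integral.
    move=> z _; rewrite /= ger0_norm ?addr_ge0 ?sqr_ge0// EFinD.
    over.
  rewrite ge0_integralD//=.
  + rewrite integral_cst// mul1e.
    rewrite [X in (X + _)%E](_ : _ = 1%E); last exact: probability_setT.
    by rewrite lte_add_pinfty ?ltry//; exact: L2_sqr_lty.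
  + by move=> z _; rewrite lee_fin sqr_ge0.
  + exact/measurable_EFinP/measurable_funX/measurable_normc/L2_cmeasurable.
- have := ae_fst (Linf_ball_ae bf); have := ae_snd (Linf_ball_ae bg).
  apply: filterS2 => z gz fz; rewrite !normcM.
  have -> : normc (f z.1)^* = normc (f z.1).
    by case: (f z.1) => a b /=; rewrite sqrrN.
  set m := normc (L2repr M z).
  have m0 : 0 <= m by exact: normc_ge0.
  apply: (@le_trans _ _ m); last by nra.
  rewrite -[leRHS]mulr1 ler_pM ?mulr_ge0 ?normc_ge0//.
  by rewrite -[leRHS]mul1r ler_wpM2r.
Qed.

Lemma cut_formZD a f (M N : L2kernel) g : Linf_ball f -> Linf_ball g ->
  cut_form f (a *: M + N) g = a * cut_form f M g + cut_form f N g.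
Proof.
move=> bf bg; rewrite -cintegralZD; try exact: cut_integrand_integrable.
case: (bf) (bg) => mf _ [mg _].
apply: eq_ae_cintegral; first exact: cut_integrand_measurable.
- apply: cmeasurableD; last exact: cut_integrand_measurable.
  apply: cmeasurableM; first exact: cmeasurable_cst.
  exact: cut_integrand_measurable.
- have := L2reprZ a M; have := L2reprD (a *: M) N.
  by apply: filterS2 => z -> ->; ring.
Qed.

Lemma Linf_ball0 : Linf_ball 0.
Proof.
split; first exact: cmeasurable_cst.
rewrite /cLnorm unlock /= probability_setT lte01; apply/ess_supP.
apply: nearW => x; rewrite [leLHS](_ : _ = `|normc (0 : R[i])|%:E)//.
by rewrite normc0 normr0 lee_fin.
Qed.

Lemma cut_norm_ge f (M : L2kernel) g : Linf_ball f -> Linf_ball g ->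
  ((normc (cut_form f M g))%:E <= cut_norm M)%E.
Proof. by move=> bf bg; apply: ereal_sup_ubound; exists (f, g). Qed.

Lemma cut_norm_le (M : L2kernel) (r : \bar R) :
  (forall f g, Linf_ball f -> Linf_ball g ->
    ((normc (cut_form f M g))%:E <= r)%E) -> (cut_norm M <= r)%E.
Proof. by move=> h; apply: ge_ereal_sup => _ [[f g] [/= bf bg] <-]; exact: h. Qed.

Lemma cut_form0 f g : Linf_ball f -> Linf_ball g -> cut_form f 0 g = 0.
Proof.
move=> bf bg; have := cut_formZD 1 0 0 bf bg.
by rewrite scale1r addr0 mul1r => /(congr1 (fun x => x - cut_form f 0 g));
  rewrite addrK subrr => <-.
Qed.

Lemma cut_norm0 : cut_norm 0 = 0%E.
Proof.
apply/le_anti/andP; split.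
  by apply: cut_norm_le => f g bf bg; rewrite cut_form0// normc0.
by have := cut_norm_ge 0 Linf_ball0 Linf_ball0; rewrite cut_form0 ?normc0//;
  exact: Linf_ball0.
Qed.

Lemma cut_normN (M : L2kernel) : cut_norm (- M) = cut_norm M.
Proof.
suff H (N : L2kernel) : (cut_norm (- N)%R <= cut_norm N)%E.
  by apply/le_anti; rewrite H -{1}[M]opprK H.
apply: cut_norm_le => f g bf bg.
rewrite -[- N]addr0 -scaleN1r cut_formZD// cut_form0// addr0 mulN1r normcN.
exact: cut_norm_ge.
Qed.

Lemma cut_normD (M N : L2kernel) : (cut_norm (M + N)%R <= cut_norm M + cut_norm N)%E.
Proof.
apply: cut_norm_le => f g bf bg.
rewrite -[M]scale1r cut_formZD// mul1r scale1r.
apply: (@le_trans _ _ ((normc (cut_form f M g))%:E + (normc (cut_form f N g))%:E)%E).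
  by rewrite -EFinD lee_fin le_normcD.
by apply: leeD; exact: cut_norm_ge.
Qed.

(* A copy of the kernel space topologized by the cut norm. *)
Definition cut_space : Type := L2kernel.
HB.instance Definition _ := GRing.Zmodule.on cut_space.

Definition cut_ball (M : cut_space) (e : R) (N : cut_space) : Prop :=
  (cut_norm (N - M)%R < e%:E)%E.

Let cut_ball_center M (e : R) : 0 < e -> cut_ball M e M.
Proof. by move=> e0; rewrite /cut_ball subrr cut_norm0 lte_fin. Qed.

Let cut_ball_sym M N (e : R) : cut_ball M e N -> cut_ball N e M.
Proof. by rewrite /cut_ball -cut_normN opprB. Qed.

Let cut_ball_triangle M N L (e1 e2 : R) :
  cut_ball M e1 N -> cut_ball N e2 L -> cut_ball M (e1 + e2) L.
Proof.
rewrite /cut_ball => h1 h2.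
rewrite (_ : L - M = (N - M) + (L - N)); last by rewrite [RHS]addrC addrA subrK.
by rewrite EFinD; apply: le_lt_trans (cut_normD _ _) _; exact: lteD.
Qed.

HB.instance Definition _ := hasNbhs.Build cut_space 
  (nbhs_ (entourage_ cut_ball)).
HB.instance Definition _ := @Nbhs_isPseudoMetric.Build R cut_space
  (entourage_ cut_ball) erefl cut_ball
  cut_ball_center cut_ball_sym cut_ball_triangle erefl.

Lemma cut_nbhsE (M : cut_space) : nbhs M = filter_from [set e : R | 0 < e]
  (fun e => [set N : cut_space | (cut_norm (N - M)%R < e%:E)%E]).
Proof.
by apply/predeqP => A; rewrite -nbhs_ballE; split=> [[e e0 H]|[e e0 H]]; exists e.
Qed.

End Kernels.

Section UnitaryGroups.
Context {d : measure_display} {T : measurableType d} {R : realType}.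
Variable mu : {measure set T -> \bar R}.

Definition unitary (a : L2 mu -> L2 mu) : Prop :=
  [/\ linear a, (forall u v, inner (a u) (a v) = inner u v) &
      forall v, exists u, a u = v].

Definition unitary_group (G : set (L2 mu -> L2 mu)) : Prop :=
  [/\ G `<=` unitary, G id, (forall a b, G a -> G b -> G (a \o b)) &
      forall a, G a -> exists b, [/\ G b, cancel a b & cancel b a]].

End UnitaryGroups.

(* Separability of the measure algebra for the metric mu (A `+` B), equivalently
   of L_2. *)
Definition separable_measure {d : measure_display} {T : measurableType d}
    {R : realType} (mu : {measure set T -> \bar R}) : Prop :=
  exists A : nat -> set T, (forall n, measurable (A n)) /\
    forall (B : set T) (e : R), measurable B -> 0 < e ->
      exists n, (mu (A n `+` B) < e%:E)%E.

Section KernelAction.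
Context {d : measure_display} {V : measurableType d} {R : realType}.
Variable P : probability V R.
Implicit Types (M : L2kernel P) (u : L2 P).

(* Fubini makes [y |-> M (x, y) * u y] integrable for a.e. [x]; on the remaining
   null set the total integral of the library takes an irrelevant value. *)
Definition kact_fun M u : V -> R[i] :=
  fun x => cintegral P (fun y => L2repr M (x, y) * u y).

Let integrand M u (z : V * V) : R[i] := L2repr M z * u z.2.

Let measurable_integrand M u : cmeasurable (integrand M u).
Proof.
apply: cmeasurableM; first exact: L2_cmeasurable.
have [ur ui] := L2_cmeasurable u; split.
  exact: (measurableT_comp ur measurable_snd).
exact: (measurableT_comp ui measurable_snd).
Qed.

Let measurable_marginal (h : V * V -> R) : measurable_fun setT h ->
  measurable_fun setT (fun x => \int[P]_y h (x, y)).
Proof.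
move=> mh; rewrite /Rintegral; apply: measurableT_comp => //.
rewrite [X in measurable_fun _ X](_ : _ = (fun x =>
  (\int[P]_y (fun y => (h (x, y))%:E)^\+ y)%E -
  (\int[P]_y (fun y => (h (x, y))%:E)^\- y)%E)%E); last first.
  by apply/funext => x; rewrite integralE.
have mh' : measurable_fun setT (EFin \o h) by exact/measurable_EFinP.
have pos := @measurable_fun_fubini_tonelli_F _ _ V V R P _
  (measurable_funepos mh') (fun=> funepos_ge0 _ _).
have neg := @measurable_fun_fubini_tonelli_F _ _ V V R P _
  (measurable_funeneg mh') (fun=> funeneg_ge0 _ _).
rewrite [X in measurable_fun _ X](_ : _ = (fun x =>
  fubini_F P ((EFin \o h)^\+) x - fubini_F P ((EFin \o h)^\-) x)%E).
  exact: (emeasurable_funB pos neg).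
apply/funext => x; rewrite /fubini_F.
by congr (_ - _)%E; apply: eq_integral => y _; rewrite ?funeposE ?funenegE.
Qed.

Let cmeasurable_kact M u : cmeasurable (kact_fun M u).
Proof.
have [mr mi] := measurable_integrand M u.
by split; [exact: (measurable_marginal mr)|exact: (measurable_marginal mi)].
Qed.

Let sqr_int_le (h a b : V -> R) :
  measurable_fun setT h -> measurable_fun setT a -> measurable_fun setT b ->
  (forall y, 0 <= a y) -> (forall y, 0 <= b y) ->
  (forall y, `|h y| <= a y * b y) ->
  ((((\int[P]_y h y) ^+ 2)%:E <=
    (\int[P]_y (a y ^+ 2)%:E) * (\int[P]_y (b y ^+ 2)%:E))%E)%R.
Proof.
move=> mh ma mb a0 b0 hab.
have mE (k : V -> R) : measurable_fun setT k -> measurable_fun setT (EFin \o k).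
  by move=> mk; exact/measurable_EFinP.
have le1 : (`|(\int[P]_y h y)%R|%:E <= 'N[P]_1[EFin \o (a \* b)%R])%E.
  apply: (@le_trans _ _ `|\int[P]_y (h y)%:E|%E).
    rewrite /Rintegral; case: (\int[P]_y (h y)%:E)%E => [r| |] //=.
    - by rewrite normr0 leey.
    - by rewrite normr0 leey.
  apply: (le_trans (le_abse_integral _ _ _)) => //; first exact: mE.
  rewrite Lnorm1; apply: ge0_le_integral => //.
  - by apply: measurableT_comp => //; exact: mE.
  - by apply: measurableT_comp => //; apply: mE; exact: measurable_funM.
  - by move=> y _ /=; rewrite lee_fin (le_trans (hab y))// ler_norm.
have N2 (k : V -> R) : (forall y, 0 <= k y) ->
  ('N[P]_2%:E[EFin \o k] `^ 2 = \int[P]_y (k y ^+ 2)%:E)%E.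
  move=> k0; rewrite poweR_Lnorm//; apply: eq_integral => y _ /=.
  by rewrite ger0_norm// powR_mulrn.
have := @hoelder _ _ _ P a b 2 2 ma mb (ltr0n _ 2) (ltr0n _ 2).
have -> : 2^-1 + 2^-1 = 1 :> R by field.
move=> /(_ erefl) le2; have {le1 le2} le3 := le_trans le1 le2.
rewrite -(N2 _ a0) -(N2 _ b0) -poweRM ?Lnorm_ge0//.
rewrite -real_normK ?num_real// -powR_mulrn ?normr_ge0// -poweR_EFin.
apply: gt0_ler_poweR => //; rewrite in_itv/=.
  by rewrite lee_fin normr_ge0 leey.
by rewrite mule_ge0 ?Lnorm_ge0 ?leey.
Qed.

Lemma kact_L2 M u : kact_fun M u \in L2pred P.
Proof.
apply/L2pred_intP; split; first exact: cmeasurable_kact.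
have [mr mi] := measurable_integrand M u.
have mM := measurable_normc (L2_cmeasurable M).
have mu' := measurable_normc (L2_cmeasurable u).
have msec x : measurable_fun setT (fun y => normc (L2repr M (x, y))).
  exact: (measurableT_comp mM (pair1_measurable x)).
set U := (\int[P]_y (normc (u y) ^+ 2)%:E)%E.
have Uoo : (U < +oo)%E by exact: L2_sqr_lty.
have U0 : (0 <= U)%E by apply: integral_ge0 => y _; rewrite lee_fin sqr_ge0.
pose W x := (\int[P]_y (normc (L2repr M (x, y)) ^+ 2)%:E)%E.
have W0 x : (0 <= W x)%E by apply: integral_ge0 => y _; rewrite lee_fin sqr_ge0.
have mM2 : measurable_fun setT (fun z => (normc (L2repr M z) ^+ 2)%:E).
  by apply/measurable_EFinP/measurable_funX.
have M20 z : (0 <= (normc (L2repr M z) ^+ 2)%:E)%E by rewrite lee_fin sqr_ge0.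
have mW : measurable_fun setT W.
  exact: (measurable_fun_fubini_tonelli_F _ mM2 M20).
have le x : ((normc (kact_fun M u x) ^+ 2)%:E <= (2%:E * U) * W x)%E.
  have -> : normc (kact_fun M u x) ^+ 2 =
      (\int[P]_y Re (integrand M u (x, y))) ^+ 2 +
      (\int[P]_y Im (integrand M u (x, y))) ^+ 2.
    by rewrite /= sqr_sqrtr// addr_ge0// sqr_ge0.
  have H (h : V -> R) : measurable_fun setT h ->
      (forall y, `|h y| <= normc (integrand M u (x, y))) ->
      (((\int[P]_y h y) ^+ 2)%:E <= W x * U)%E.
    move=> mh hle; apply: (sqr_int_le mh (msec x) mu') => y; try exact: normc_ge0.
    by rewrite -normcM hle.
  have -> : (2%:E * U * W x = W x * U + W x * U)%E.
    by rewrite -muleA [(U * _)%E]muleC mule_natl.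
  rewrite EFinD; apply: leeD; apply: H => //.
  - exact: (measurableT_comp mr (pair1_measurable x)).
  - by move=> y; have [] := normc_ge_ReIm (integrand M u (x, y)).
  - exact: (measurableT_comp mi (pair1_measurable x)).
  - by move=> y; have [] := normc_ge_ReIm (integrand M u (x, y)).
apply: (@le_lt_trans _ _ (\int[P]_x ((2%:E * U) * W x))%E).
  apply: ge0_le_integral => //.
  - by move=> x _; rewrite lee_fin sqr_ge0.
  - by apply/measurable_EFinP/measurable_funX/measurable_normc/cmeasurable_kact.
  - exact: measurable_funeM.
rewrite ge0_integralZl// ?mule_ge0// ?lee_fin//.
rewrite lte_mul_pinfty ?mule_ge0 ?lee_fin//.
  by rewrite fin_numM// ge0_fin_numE.
have -> : (\int[P]_x W x = \int[(P \x P)%E]_z (normc (L2repr M z) ^+ 2)%:E)%E.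
  by rewrite fubini_tonelli1.
exact: L2_sqr_lty.
Qed.

Definition kact M u : L2 P := L2class (MkL2fun (kact_L2 M u)).

Definition self_adjoint M : Prop :=
  {ae (P \x P)%E, forall z, L2repr M z = (L2repr M (z.2, z.1))^*}.

(* [b] stands for the inverse of [a]: the equation is a M a^-1 = M. *)
Definition kernel_invariant (G : set (L2 P -> L2 P)) M : Prop :=
  forall a b, G a -> cancel a b -> cancel b a -> a \o kact M \o b = kact M.

Definition invariant_kernels (G : set (L2 P -> L2 P)) (c : R) : set (L2kernel P) :=
  [set M | [/\ self_adjoint M, kernel_invariant G M &
               (cLnorm (P \x P)%E +oo (L2repr M) <= c%:E)%E]].

End KernelAction.

(* Main.v *)
Require Import Defs.
From mathcomp Require Import all_boot all_order all_algebra.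
From mathcomp Require Import all_classical all_reals all_analysis.
From mathcomp Require Import complex.
From HB Require Import structures.
From mathcomp Require Import measurable_realfun ess_sup_inf ring lra.
Import Defs.

Set Implicit Arguments.
Unset Strict Implicit.
Unset Printing Implicit Defensive.

Import Order.TTheory GRing.Theory Num.Theory.
Import numFieldNormedType.Exports.
Import complex Normc.

Local Open Scope complex_scope.
Local Open Scope classical_set_scope.
Local Open Scope ring_scope.

(* A kernel [M] of the set has Hilbert-Schmidt norm at most [c], so for s > 0
   the eigenspace of [M^2] for s^2 has dimension at most (c / s)^2, and it is
   invariant under [G] because [M] commutes with [G]. Weak randomness therefore
   provides, for every eps > 0, one finite dimensional space [W] containing these
   eigenspaces for all kernels of the set and all s > eps; [W] is stable under
   these kernels, and each of them has norm at most eps on the orthogonal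
   complement of [W], since a compact self-adjoint operator attains its norm at
   an eigenvector of its square. Hence the form f^* (N - M) g is controlled, up
   to 2 eps and uniformly in [f] and [g], by the finitely many coefficients of
   [N - M] on [W], and these tend to 0 under weak convergence. Conversely,
   cut norm convergence tests [N - M] against indicators of rectangles, which
   span a dense subspace of L_2(V x V), and the set is bounded in L_2. For
   compactness, along an ultrafilter the integrals of the kernels over
   measurable sets converge to a complex measure with a bounded density: the
   Radon-Nikodym theorem gives the weak limit, and it stays in the set. *)

(** * Complex integrals and the Hilbert space L_2 *)

(** The eigenspaces are those of [M^2] because maximizing the norm of [M u] over unit vectors yields
    an eigenvector of the square only: [M] itself may have the eigenvalue [s] or [-s]. That the norm
    on the complement of [W] is attained requires a limit of almost maximizing vectors. These are
    merely bounded in L_2, but a bounded kernel maps the unit ball of L_2 to uniformly bounded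
    functions, so the Radon-Nikodym construction that gives limits of kernels also gives weak limits
    of the images. Density is used as an induction principle: the vectors or kernels with a given
    property are shown to form a closed subspace that contains the indicators of sets or rectangles.
    For convergence along a filter, closedness comes from an eventual L_2 bound. In the cut norm
    estimate only g is split along [W]: since [N - M] maps [W] to itself, the part of g in [W]
    involves finitely many coefficients, whatever f is. *)

Section Complex.
Context {R : realType}.
Implicit Types z w : R[i].

Lemma normc_conj z : normc z^* = normc z.
Proof. by case: z => a b /=; rewrite sqrrN. Qed.

Lemma normc_real (r : R) : normc r%:C = `|r|.
Proof. by rewrite /= expr0n /= addr0 sqrtr_sqr. Qed.

Lemma conj_real (r : R) : (r%:C)^* = r%:C.
Proof. exact: conjc_real. Qed.

Lemma mul_conjc z : z^* * z = (normc z ^+ 2)%:C.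
Proof.
case: z => a b /=; rewrite sqr_sqrtr ?addr_ge0 ?sqr_ge0//.
by apply/eqP; rewrite eq_complex /=; apply/andP; split; apply/eqP; ring.
Qed.

Lemma realcM (r s : R) : (r * s)%:C = r%:C * s%:C.
Proof. exact: rmorphM. Qed.

Lemma realcB (r s : R) : (r - s)%:C = r%:C - s%:C.
Proof. exact: rmorphB. Qed.

Lemma ReD z w : Re (z + w) = Re z + Re w. Proof. by case: z; case: w. Qed.
Lemma ImD z w : Im (z + w) = Im z + Im w. Proof. by case: z; case: w. Qed.
Lemma ReN z : Re (- z) = - Re z. Proof. by case: z. Qed.
Lemma ReM z w : Re (z * w) = Re z * Re w - Im z * Im w.
Proof. by case: z; case: w. Qed.
Lemma ImM z w : Im (z * w) = Re z * Im w + Im z * Re w.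
Proof. by case: z; case: w. Qed.
Lemma ReZ (r : R) z : Re (r%:C * z) = r * Re z.
Proof. by case: z => a b /=; rewrite mul0r subr0. Qed.
Lemma ImZ (r : R) z : Im (r%:C * z) = r * Im z.
Proof. by case: z => a b /=; rewrite mul0r addr0. Qed.
Lemma conjcM z w : (z * w)^* = z^* * w^*.
Proof. exact: rmorphM. Qed.
Lemma conjcD z w : (z + w)^* = z^* + w^*.
Proof. exact: rmorphD. Qed.

Lemma normcB z w : normc (z - w) = normc (w - z).
Proof. by rewrite -normcN opprB. Qed.

Lemma Re_le_normc z : Re z <= normc z.
Proof. by have [h _] := normc_ge_ReIm z; exact: le_trans (ler_norm _) h. Qed.

Lemma normc_le_ReIm z : normc z <= `|Re z| + `|Im z|.
Proof.
case: z => a b /=; rewrite -(@ler_pXn2r _ 2)// ?nnegrE ?sqrtr_ge0 ?addr_ge0//.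
rewrite sqr_sqrtr ?addr_ge0 ?sqr_ge0// sqrrD !real_normK ?num_real//.
by rewrite lerD2r lerDl mulrn_wge0// mulr_ge0.
Qed.

Lemma normc_sum (I : Type) (r : seq I) (P : pred I) (F : I -> R[i]) :
  normc (\sum_(i <- r | P i) F i) <= \sum_(i <- r | P i) normc (F i).
Proof.
elim/big_ind2 : _ => //; first by rewrite normc0.
by move=> x1 x2 y1 y2 h1 h2; apply: le_trans (le_normcD _ _) _; exact: lerD.
Qed.

End Complex.

Section ComplexIntegral.
Context {d : measure_display} {T : measurableType d} {R : realType}.
Variable mu : {measure set T -> \bar R}.
Implicit Types f g : T -> R[i].

Lemma cintegrableZD a f g : cintegrable mu f -> cintegrable mu g ->
  cintegrable mu (fun x => a * f x + g x).
Proof.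
move=> [fr fi] [gr gi].
have iZ (c : R) h : mu.-integrable setT (fun x => (h x)%:E) ->
  mu.-integrable setT (fun x => (c * h x)%:E).
  by move=> ih; under eq_fun do rewrite EFinM; exact: integrableZl.
have iD h k : mu.-integrable setT (fun x => (h x)%:E) ->
   mu.-integrable setT (fun x => (k x)%:E) ->
   mu.-integrable setT (fun x => (h x + k x)%:E).
  by move=> ih ik; under eq_fun do rewrite EFinD; exact: integrableD.
split.
  under eq_fun do rewrite ReD ReM -mulNr.
  by apply: (iD) => //; apply: iD; exact: iZ.
under eq_fun do rewrite ImD ImM.
by apply: (iD) => //; apply: iD; exact: iZ.
Qed.

Lemma cintegrable0 : cintegrable mu (fun=> 0).
Proof. by split; exact: integrable0. Qed.

Lemma cintegrableZ a f : cintegrable mu f -> cintegrable mu (fun x => a * f x).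
Proof.
move=> h; rewrite (_ : (fun _ => _) = (fun x => a * f x + 0)).
  exact: cintegrableZD h cintegrable0.
by apply/funext => x; rewrite addr0.
Qed.

Lemma cintegral0 : cintegral mu (fun=> 0) = 0.
Proof. by rewrite /cintegral /Rintegral integral0. Qed.

Lemma cintegralZ a f : cintegrable mu f ->
  cintegral mu (fun x => a * f x) = a * cintegral mu f.
Proof.
move=> h; rewrite (_ : (fun _ => _) = (fun x => a * f x + 0)).
  by rewrite cintegralZD//; [rewrite cintegral0 addr0|exact: cintegrable0].
by apply/funext => x; rewrite addr0.
Qed.

Lemma cintegralD f g : cintegrable mu f -> cintegrable mu g ->
  cintegral mu (fun x => f x + g x) = cintegral mu f + cintegral mu g.
Proof.
move=> hf hg; rewrite (_ : (fun _ => _) = (fun x => 1 * f x + g x)).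
  by rewrite cintegralZD// mul1r.
by apply/funext => x; rewrite mul1r.
Qed.

Lemma cintegral_conj f : cintegrable mu f ->
  cintegral mu (fun x => (f x)^*) = (cintegral mu f)^*.
Proof.
move=> [_ fi]; rewrite /cintegral /=; congr (_ +i* _).
  by apply: eq_Rintegral => x _; case: (f x).
rewrite -[RHS]mulN1r -RintegralZl//.
by apply: eq_Rintegral => x _; rewrite mulN1r; case: (f x).
Qed.

Lemma cintegrable_normc f : cmeasurable f -> cintegrable mu f ->
  mu.-integrable setT (EFin \o (fun x => normc (f x))).
Proof.
move=> mf [fr fi].
apply: (@le_integrable _ _ _ mu _ measurableT _
   (fun x => (`|Re (f x)| + `|Im (f x)|)%:E)).
- exact/measurable_EFinP/measurable_normc.
- move=> x _ /=; rewrite lee_fin [leLHS]ger0_norm ?normc_ge0// [leRHS]ger0_norm ?addr_ge0//.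
  exact: normc_le_ReIm.
- under eq_fun do rewrite EFinD.
  by apply: integrableD => //; exact: integrable_norm.
Qed.

Lemma le_normc_cintegral f : cmeasurable f -> cintegrable mu f ->
  normc (cintegral mu f) <= \int[mu]_x normc (f x).
Proof.
move=> mf ifi; set z := cintegral mu f.
have [->|z0] := eqVneq z 0.
  by rewrite normc0; apply: Rintegral_ge0 => x _; exact: normc_ge0.
have nz : 0 < normc z.
  by rewrite lt_def normc_ge0 andbT; apply: contra_neq z0; exact: eq0_normc.
rewrite -(ler_pM2l nz) -RintegralZl//; last exact: cintegrable_normc.
(* Multiplying by [z^*] rotates the integral onto the positive real axis, where it is bounded
   through its real part. *)
have -> : normc z * normc z = Re (cintegral mu (fun x => z^* * f x)).
  by rewrite cintegralZ// -/z mul_conjc.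
rewrite /cintegral; cbn [complex.Re].
apply: le_Rintegral => //.
- by have [] := cintegrableZ (z^*) ifi.
- rewrite [X in integrable _ _ X](_ : _ =
      (fun x => (normc z)%:E * (normc (f x))%:E)%E)//.
  by apply: integrableZl => //; exact: cintegrable_normc.
- move=> x _; apply: le_trans (Re_le_normc _) _.
  by rewrite normcM normc_conj.
Qed.

End ComplexIntegral.

Section InnerProduct.
Context {d : measure_display} {T : measurableType d} {R : realType}.
Variable mu : {measure set T -> \bar R}.
Implicit Types u v w : L2 mu.

Lemma integrable_sqr_L2 u :
  mu.-integrable setT (EFin \o (fun x => normc (u x) ^+ 2)).
Proof.
apply/integrableP; split.
  exact/measurable_EFinP/measurable_funX/measurable_normc/L2_cmeasurable.
have := L2_sqr_lty u; apply: le_lt_trans.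
rewrite le_eqVlt; apply/orP; left; apply/eqP.
by apply: eq_integral => x _ /=; rewrite ger0_norm// sqr_ge0.
Qed.

Lemma cmeasurable_inner u v : cmeasurable (fun x => (u x)^* * v x).
Proof.
by apply: cmeasurableM; [apply: cmeasurable_conj|]; exact: L2_cmeasurable.
Qed.

Lemma cintegrable_inner u v : cintegrable mu (fun x => (u x)^* * v x).
Proof.
apply: (@cintegrable_dom _ _ _ _ _ (fun x => normc (u x) ^+ 2 + normc (v x) ^+ 2)).
- exact: cmeasurable_inner.
- rewrite [X in integrable _ _ X](_ : _ = 
    (fun x => (normc (u x) ^+ 2)%:E + (normc (v x) ^+ 2)%:E)%E)//.
  by apply: integrableD => //; exact: integrable_sqr_L2.
- apply: nearW => x; rewrite normcM normc_conj.
  by have := normc_ge0 (u x); have := normc_ge0 (v x); nra.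
Qed.

Lemma innerDr u v w : inner u (v + w) = inner u v + inner u w.
Proof.
rewrite /inner -cintegralD; try exact: cintegrable_inner.
apply: eq_ae_cintegral; first exact: cmeasurable_inner.
  by apply: cmeasurableD; exact: cmeasurable_inner.
by have := L2reprD v w; apply: filterS => x ->; rewrite mulrDr.
Qed.

Lemma innerZr a u v : inner u (a *: v) = a * inner u v.
Proof.
rewrite /inner -cintegralZ; last exact: cintegrable_inner.
apply: eq_ae_cintegral; first exact: cmeasurable_inner.
  by apply: cmeasurableM; [exact: cmeasurable_cst|exact: cmeasurable_inner].
by have := L2reprZ a v; apply: filterS => x ->; rewrite mulrCA.
Qed.

Lemma innerC u v : inner v u = (inner u v)^*.
Proof.
rewrite /inner -cintegral_conj; last exact: cintegrable_inner.
by congr cintegral; apply/funext => x; rewrite conjcM conjCK mulrC.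
Qed.

Lemma innerDl u v w : inner (u + v) w = inner u w + inner v w.
Proof. by rewrite innerC innerDr conjcD -!innerC. Qed.

Lemma innerZl a u w : inner (a *: u) w = a^* * inner u w.
Proof. by rewrite innerC innerZr conjcM -innerC. Qed.

Lemma inner0r u : inner u 0 = 0.
Proof. by rewrite -(scale0r 0) innerZr mul0r. Qed.

Lemma inner0l u : inner 0 u = 0.
Proof. by rewrite innerC inner0r conjC0. Qed.

Lemma innerNr u v : inner u (- v) = - inner u v.
Proof. by rewrite -scaleN1r innerZr mulN1r. Qed.

Lemma innerNl u v : inner (- u) v = - inner u v.
Proof. by rewrite -scaleN1r innerZl rmorphN1 mulN1r. Qed.

Lemma innerBr u v w : inner u (v - w) = inner u v - inner u w.
Proof. by rewrite innerDr innerNr. Qed.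

Lemma innerBl u v w : inner (u - v) w = inner u w - inner v w.
Proof. by rewrite innerDl innerNl. Qed.

Lemma inner_sumr (I : Type) (r : seq I) (Q : pred I) (F : I -> L2 mu) u :
  inner u (\sum_(i <- r | Q i) F i) = \sum_(i <- r | Q i) inner u (F i).
Proof.
by elim/big_rec2 : _ => [|i x y _ <-]; rewrite ?inner0r// innerDr.
Qed.

Lemma inner_suml (I : Type) (r : seq I) (Q : pred I) (F : I -> L2 mu) u :
  inner (\sum_(i <- r | Q i) F i) u = \sum_(i <- r | Q i) inner (F i) u.
Proof.
by elim/big_rec2 : _ => [|i x y _ <-]; rewrite ?inner0l// innerDl.
Qed.

Definition sqnorm u : R := \int[mu]_x normc (u x) ^+ 2.

Lemma sqnorm_ge0 u : 0 <= sqnorm u.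
Proof. by apply: Rintegral_ge0 => x _; exact: sqr_ge0. Qed.

Lemma inner_sqnorm u : inner u u = (sqnorm u)%:C.
Proof.
rewrite /inner /cintegral; under [X in X +i* _]eq_Rintegral do rewrite mul_conjc.
rewrite [X in _ +i* X](_ : _ = 0)//.
under eq_Rintegral do rewrite mul_conjc.
by rewrite /Rintegral integral0.
Qed.

Lemma L2class0 : L2class 0 = 0 :> L2 mu.
Proof. by apply: (addrI (L2class 0)); rewrite -L2classD !addr0. Qed.

Lemma sqnorm_eq0 u : sqnorm u = 0 -> u = 0.
Proof.
move=> h; apply: L2_ext.
have iu := integrable_sqr_L2 u.
have : (\int[mu]_x `|(normc (u x) ^+ 2)%:E| = 0)%E.
  (* The real integral is [fine] of the extended one and would also be 0 if that were infinite;
     integrability excludes this. *)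
  have /fineK E := integrable_fin_num measurableT iu.
  have {}E := etrans (congr1 EFin (esym h)) E.
  apply: etrans (esym E).
  by apply: eq_integral => x _ /=; rewrite ger0_norm// sqr_ge0.
move/(ae_eq_integral_abs mu measurableT (measurable_int _ iu)).
have : {ae mu, forall x, (0 : L2 mu) x = 0}.
  by rewrite -L2class0; exact: L2reprK.
apply: filterS2 => x -> /(_ I) [] /eqP; rewrite sqrf_eq0 => /eqP nu; exact: (@eq0_normc _ (u x) nu).
Qed.

Definition L2norm u : R := Num.sqrt (sqnorm u).

Lemma L2norm_ge0 u : 0 <= L2norm u.
Proof. exact: sqrtr_ge0. Qed.

Lemma sqr_L2norm u : L2norm u ^+ 2 = sqnorm u.
Proof. by rewrite sqr_sqrtr// sqnorm_ge0. Qed.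

Lemma sqnormZ a u : sqnorm (a *: u) = normc a ^+ 2 * sqnorm u.
Proof.
apply: (@complexI R); rewrite -inner_sqnorm innerZl innerZr mulrA mul_conjc.
by rewrite inner_sqnorm -realcM.
Qed.

Lemma L2normZ a u : L2norm (a *: u) = normc a * L2norm u.
Proof.
by rewrite /L2norm sqnormZ sqrtrM ?sqr_ge0// sqrtr_sqr ger0_norm// normc_ge0.
Qed.

Lemma L2normN u : L2norm (- u) = L2norm u.
Proof. by rewrite -scaleN1r L2normZ normcN normc1 mul1r. Qed.

Lemma L2norm0 : L2norm 0 = 0.
Proof. by rewrite -(scale0r 0) L2normZ normc0 mul0r. Qed.

Lemma L2norm_eq0 u : L2norm u = 0 -> u = 0.
Proof. by move=> h; apply: sqnorm_eq0; rewrite -sqr_L2norm h expr0n. Qed.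

Lemma sqnormD u v : sqnorm (u + v) = sqnorm u + 2 * Re (inner u v) + sqnorm v.
Proof.
have -> : sqnorm (u + v) = Re (inner (u + v) (u + v)) by rewrite inner_sqnorm.
rewrite innerDl !innerDr !inner_sqnorm (innerC u v) !ReD /=.
by case: (inner u v) => a b /=; ring.
Qed.

Lemma sqnormB u v : sqnorm (u - v) = sqnorm u - 2 * Re (inner u v) + sqnorm v.
Proof.
by rewrite sqnormD innerNr ReN -!sqr_L2norm L2normN mulrN.
Qed.

Lemma CauchySchwarz u v : normc (inner u v) <= L2norm u * L2norm v.
Proof.
have [u0|u0] := eqVneq (sqnorm u) 0.
  by rewrite (sqnorm_eq0 u0) inner0l normc0 mulr_ge0// L2norm_ge0.
have up : 0 < sqnorm u by rewrite lt_def u0 sqnorm_ge0.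
rewrite -(@ler_pXn2r _ 2)// ?nnegrE ?normc_ge0 ?mulr_ge0 ?L2norm_ge0//.
rewrite exprMn !sqr_L2norm.
set N := normc _.
(* Up to the factor [sqnorm u], this vector is the component of [v] orthogonal to [u]; the factor
   avoids a division. *)
have := sqnorm_ge0 ((sqnorm u)%:C *: v - inner u v *: u).
rewrite sqnormB !sqnormZ normc_real innerZl innerZr conj_real.
rewrite (innerC u v) (mulrC (inner u v)) mul_conjc -/N ReZ /= ger0_norm ?sqnorm_ge0//.
have -> : sqnorm u ^+ 2 * sqnorm v - 2 * (sqnorm u * N ^+ 2) + N ^+ 2 * sqnorm u =
   sqnorm u * (sqnorm u * sqnorm v - N ^+ 2) by ring.
by rewrite pmulr_rge0// subr_ge0.
Qed.

Lemma L2normD u v : L2norm (u + v) <= L2norm u + L2norm v.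
Proof.
rewrite -(@ler_pXn2r _ 2)// ?nnegrE ?L2norm_ge0 ?addr_ge0 ?L2norm_ge0//.
rewrite sqr_L2norm sqnormD -!sqr_L2norm.
have := le_trans (Re_le_normc _) (CauchySchwarz u v); nra.
Qed.

Lemma L2normB u v : L2norm (u - v) <= L2norm u + L2norm v.
Proof. by rewrite -(L2normN v) L2normD. Qed.

End InnerProduct.

(** * Orthonormal families *)

Section Span.
Context {K : fieldType} {H : lmodType K}.
Implicit Types (A S : set H) (u v : H).

Definition subspace S := S 0 /\ forall a u v, S u -> S v -> S (a *: u + v).

Lemma subspaceZ S a u : subspace S -> S u -> S (a *: u).
Proof. by move=> [S0 SS] Su; rewrite -[_ *: _]addr0; exact: SS. Qed.

Lemma subspaceB S u v : subspace S -> S u -> S v -> S (u - v).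
Proof. by move=> [S0 SS] Su Sv; rewrite addrC -scaleN1r; exact: SS. Qed.

Lemma subspace_sum S n (a : 'I_n -> K) (x : 'I_n -> H) : subspace S ->
  (forall i, S (x i)) -> S (\sum_i a i *: x i).
Proof. by move=> [S0 SS] Sx; elim/big_rec : _ => // i y _ Sy; exact: SS. Qed.

Lemma span_subset A S : subspace S -> A `<=` S -> span A `<=` S.
Proof.
by move=> sS AS _ [n [a [x [Ax ->]]]]; apply: subspace_sum => // i; exact/AS.
Qed.

Lemma subset_span A : A `<=` span A.
Proof.
move=> u Au; exists 1%N, (fun=> 1), (fun=> u); split => //.
by rewrite big_ord1 scale1r.
Qed.

Lemma subspace_span A : subspace (span A).
Proof.
split; first by exists 0%N, (fun=> 0), (fun=> 0); split=> [[]//|]; rewrite big_ord0.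
move=> c _ _ [n [a [x [Ax ->]]]] [m [b [y [Ay ->]]]].
exists (n + m)%N, (fun i => match fintype.split i with inl j => c * a j | inr j => b j end),
  (fun i => match fintype.split i with inl j => x j | inr j => y j end); split.
  by move=> i; case: splitP => j _.
rewrite big_split_ord /= scaler_sumr; congr (_ + _); apply: eq_bigr => i _.
  by rewrite -[lshift m i]/(unsplit (inl i)) unsplitK scalerA.
by rewrite -[rshift n i]/(unsplit (inr i)) unsplitK.
Qed.

Lemma dim_leW k n S : (k <= n)%N -> dim_le k S -> dim_le n S.
Proof.
move=> kn [x ->].
(* Padding with zero vectors leaves the span unchanged. *)
exists (fun i : 'I_n => if insub (i : nat) is Some j then x j else 0).
apply/seteqP; split; apply: span_subset; try exact: subspace_span.
  move=> _ [j _ <-]; apply: subset_span; exists (widen_ord kn j) => //=.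
  by rewrite insubT//= => ?; congr x; exact: val_inj.
move=> _ [i _ <-]; case: insubP => [j _ _|_].
  by apply: subset_span; exists j.
by have [] := subspace_span (range x).
Qed.

End Span.

Section Orthonormal.
Context {d : measure_display} {T : measurableType d} {R : realType}.
Variable mu : {measure set T -> \bar R}.
Implicit Types (u v w : L2 mu) (S : set (L2 mu)).

Definition orthonormal k (e : 'I_k -> L2 mu) :=
  forall i j, inner (e i) (e j) = (i == j)%:R.

Definition proj k (e : 'I_k -> L2 mu) v := \sum_i inner (e i) v *: e i.

Section Projection.
Variables (k : nat) (e : 'I_k -> L2 mu).
Hypothesis eON : orthonormal e.

Lemma inner_lincomb (a : 'I_k -> R[i]) j : inner (e j) (\sum_i a i *: e i) = a j.
Proof.
rewrite inner_sumr (bigD1 j)//= innerZr eON eqxx mulr1 big1 ?addr0// => i ij.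
by rewrite innerZr eON eq_sym (negbTE ij) mulr0.
Qed.

Lemma inner_proj j v : inner (e j) (v - proj e v) = 0.
Proof. by rewrite innerBr inner_lincomb subrr. Qed.

Lemma sqnorm_lincomb (a : 'I_k -> R[i]) :
  sqnorm (\sum_i a i *: e i) = \sum_i normc (a i) ^+ 2.
Proof.
apply: (@complexI R); rewrite -inner_sqnorm inner_suml rmorph_sum /=.
by apply: eq_bigr => i _; rewrite innerZl inner_lincomb mul_conjc.
Qed.

Lemma proj_pythagoras v :
  sqnorm v = sqnorm (v - proj e v) + \sum_i normc (inner (e i) v) ^+ 2.
Proof.
rewrite -sqnorm_lincomb -/(proj e v) -[v in LHS](subrK (proj e v)).
rewrite (sqnormD (v - _)).
have -> : inner (v - proj e v) (proj e v) = 0.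
  rewrite inner_sumr big1// => i _.
  by rewrite innerZr (innerC (e i)) inner_proj conjC0 mulr0.
by rewrite mulr0 addr0.
Qed.

Lemma Bessel v : \sum_i normc (inner (e i) v) ^+ 2 <= sqnorm v.
Proof. by rewrite [leRHS]proj_pythagoras lerDr sqnorm_ge0. Qed.

Lemma L2norm_proj_le v : L2norm (v - proj e v) <= L2norm v.
Proof.
rewrite ler_sqrt ?sqnorm_ge0// [leRHS]proj_pythagoras lerDl sumr_ge0// => i _.
exact: sqr_ge0.
Qed.

Lemma orthonormal_free (a : 'I_k -> R[i]) : \sum_i a i *: e i = 0 ->
  forall i, a i = 0.
Proof. by move=> a0 i; rewrite -(inner_lincomb a i) a0 inner0r. Qed.

End Projection.

(** An orthonormal family in [S] of maximal size is a basis: a nonzero residue [v - proj e v], once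
    normalized, would extend it. A bound on the size of orthonormal families thus replaces any prior
    knowledge of the dimension. *)
Lemma orthonormal_basis S n : subspace S ->
  (forall k (e : 'I_k -> L2 mu), orthonormal e -> (forall i, S (e i)) ->
    (k <= n)%N) ->
  exists k (e : 'I_k -> L2 mu), [/\ (k <= n)%N, orthonormal e,
    forall i, S (e i) & forall v, S v -> v = proj e v].
Proof.
move=> sS bnd.
pose Q k := `[< exists e : 'I_k -> L2 mu, orthonormal e /\ forall i, S (e i) >].
have Q0 : exists k, Q k.
  by exists 0%N; apply/asboolP; exists (fun=> 0); split; case.
have Qn k : Q k -> (k <= n)%N by move=> /asboolP[e [eON eS]]; exact: bnd eON eS.
case: (ex_maxnP Q0 Qn) => k Qk kmax; have /asboolP[e [eON eS]] := Qk.
exists k, e; split => //; first exact: Qn.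
move=> v Sv; apply/eqP; rewrite -subr_eq0; apply/negPn/negP => r0.
set r := v - proj e v in r0.
have Sr : S r by apply: subspaceB => //; exact: subspace_sum.
have nr0 : L2norm r != 0 by apply: contra_neq r0; exact: L2norm_eq0.
pose r' := ((L2norm r)^-1)%:C *: r.
have r'1 : inner r' r' = 1.
  rewrite inner_sqnorm -sqr_L2norm L2normZ normc_real ger0_norm ?invr_ge0 ?L2norm_ge0//.
  by rewrite mulVf// expr1n.
have er' i : inner (e i) r' = 0 by rewrite innerZr inner_proj// mulr0.
have r'e i : inner r' (e i) = 0 by rewrite innerC er' conjC0.
suff /kmax : Q k.+1 by rewrite ltnn.
apply/asboolP.
(* The last index carries the new vector, the others the old family. *)
exists (fun i => if unlift ord_max i is Some j then e j else r'); split.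
  move=> i j; case: unliftP => [i'|] ->; case: unliftP => [j'|] ->.
  - by rewrite eON (inj_eq lift_inj).
  - by rewrite er' eq_sym (negbTE (neq_lift _ _)).
  - by rewrite r'e (negbTE (neq_lift _ _)).
  - by rewrite r'1 eqxx.
move=> i; case: unliftP => [i'|] _; first exact: eS.
exact: subspaceZ.
Qed.

(** If [k > n], the [k] by [n] matrix of coefficients has a nonzero row vector in its left kernel,
    which is a linear relation between the [e i]. *)
Lemma orthonormal_span_leq n (x : 'I_n -> L2 mu) k (e : 'I_k -> L2 mu) :
  orthonormal e -> (forall i, span (range x) (e i)) -> (k <= n)%N.
Proof.
move=> eON ex.
have sx v : span (range x) v -> exists a : 'rV[R[i]]_n, v = \sum_j a 0 j *: x j.
  apply: (@span_subset _ _ (range x)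
    [set v | exists a : 'rV[R[i]]_n, v = \sum_j a 0 j *: x j]).
    split=> [|c _ _ [a ->] [b ->]].
      by exists 0; rewrite big1// => j _; rewrite mxE scale0r.
    exists (c *: a + b); rewrite scaler_sumr -big_split; apply: eq_bigr => j _.
    by rewrite !mxE scalerDl scalerA.
  move=> _ [j _ <-]; exists (delta_mx 0 j); rewrite (bigD1 j)//= big1 => [|i ij].
    by rewrite mxE !eqxx scale1r addr0.
  by rewrite mxE (negbTE ij) andbF scale0r.
have {sx}/choice[a ea] := fun i => sx _ (ex i).
pose A := \matrix_(i < k) a i.
rewrite leqNgt; apply/negP => nk.
have : kermx A != 0.
  rewrite -mxrank_eq0 mxrank_ker -lt0n subn_gt0.
  exact: leq_ltn_trans (rank_leq_col A) nk.
move=> /rowV0Pn[u /sub_kermxP uA /negP]; apply; apply/eqP/rowP => i.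
rewrite mxE; apply: (orthonormal_free eON (a := fun i => u 0 i)).
under eq_bigr do rewrite ea scaler_sumr.
rewrite exchange_big big1//= => j _.
under eq_bigr do rewrite scalerA.
rewrite -scaler_suml; have /rowP/(_ j) := uA.
rewrite !mxE => uAj; rewrite [X in X *: _](_ : _ = 0) ?scale0r// -[RHS]uAj.
by apply: eq_bigr => l _; rewrite !mxE.
Qed.

Lemma finite_dim_orthonormal_basis S : finite_dim S ->
  exists k (e : 'I_k -> L2 mu), [/\ orthonormal e,
    forall i, S (e i) & forall v, S v -> v = proj e v].
Proof.
move=> [n [x ->]].
have [] := @orthonormal_basis (span (range x)) n (subspace_span _).
  by move=> k e; exact: orthonormal_span_leq.
by move=> k [e [_ eON eS eB]]; exists k, e.
Qed.

(** The Hilbert-Schmidt norm bounds only the size of orthonormal families; this turns such a bound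
    into the [dim_le] that weak randomness asks for. *)
Lemma orthonormal_dim_le S n : subspace S ->
  (forall k (e : 'I_k -> L2 mu), orthonormal e -> (forall i, S (e i)) ->
    (k <= n)%N) -> dim_le n S.
Proof.
move=> sS /(orthonormal_basis sS)[k [e [kn eON eS eB]]].
apply: dim_leW kn _; exists e; apply/seteqP; split.
  move=> v /eB ->; apply: subspace_sum; first exact: subspace_span.
  by move=> i; apply: subset_span; exists i.
by apply: span_subset => // _ [i _ <-].
Qed.

End Orthonormal.

(** * Kernel operators *)

Section ProductIntegral.
Context {d : measure_display} {V : measurableType d} {R : realType}.
Variable P : probability V R.

(** The inner integral enters through a function [g] equal to it almost everywhere, so that a
    representative of a class of L_2, such as [kact M v], can stand for it. *)
Lemma Rintegral_fubini (f : V * V -> R) (g : V -> R) :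
  (P \x P)%E.-integrable setT (EFin \o f) -> measurable_fun setT g ->
  {ae P, forall x, g x = \int[P]_y f (x, y)} ->
  \int[(P \x P)%E]_z f z = \int[P]_x g x.
Proof.
move=> fi mg gE; rewrite /Rintegral; congr fine.
have FI := integrable_fubini_F fi.
rewrite -[LHS](integral12_prod_meas1 fi); apply: ae_eq_integral => //.
- exact: measurable_int FI.
- exact/measurable_EFinP.
- have := ae_integrable1 fi; apply: filterS2 gE => x -> fx _ /=.
  by rewrite fineK//; exact: integrable_fin_num fx.
Qed.

Lemma cintegral_fubini (f : V * V -> R[i]) (g : V -> R[i]) :
  cintegrable (P \x P)%E f -> cmeasurable g ->
  {ae P, forall x, g x = cintegral P (fun y => f (x, y))} ->
  cintegral (P \x P)%E f = cintegral P g.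
Proof.
move=> [fr fi] [gr gi] gE.
rewrite /cintegral (Rintegral_fubini fr gr) ?(Rintegral_fubini fi gi)//;
  by apply: filterS gE => x ->.
Qed.

Lemma ae_cintegrable (f : V * V -> R[i]) : cintegrable (P \x P)%E f ->
  {ae P, forall x, cintegrable P (fun y => f (x, y))}.
Proof.
move=> [fr fi]; have := ae_integrable1 fr; have := ae_integrable1 fi.
by apply: filterS2.
Qed.

Lemma ge0_integral_swap (g : V * V -> \bar R) : measurable_fun setT g ->
  (forall z, (0 <= g z)%E) ->
  (\int[(P \x P)%E]_z g (z.2, z.1) = \int[(P \x P)%E]_z g z)%E.
Proof.
move=> mg g0; rewrite [RHS](fubini_tonelli2 g)//.
rewrite (fubini_tonelli1 (fun z => g (z.2, z.1)))//.
exact: (measurableT_comp mg (@measurable_swap _ _ _ _)).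
Qed.

Lemma Rintegral_swap (f : V * V -> R) : measurable_fun setT f ->
  \int[(P \x P)%E]_z f (z.2, z.1) = \int[(P \x P)%E]_z f z.
Proof.
move=> mf; rewrite /Rintegral; congr fine.
have mf' : measurable_fun setT (EFin \o f) by exact/measurable_EFinP.
rewrite integralE [RHS]integralE; congr (_ - _)%E.
  rewrite -(ge0_integral_swap (measurable_funepos mf') (fun=> funepos_ge0 _ _)).
  by apply: eq_integral => z _; rewrite !funeposE.
rewrite -(ge0_integral_swap (measurable_funeneg mf') (fun=> funeneg_ge0 _ _)).
by apply: eq_integral => z _; rewrite !funenegE.
Qed.

Lemma cintegral_swap (f : V * V -> R[i]) : cmeasurable f ->
  cintegral (P \x P)%E (fun z => f (z.2, z.1)) = cintegral (P \x P)%E f.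
Proof.
by move=> [mr mi]; rewrite /cintegral (Rintegral_swap mr) (Rintegral_swap mi).
Qed.

Lemma cmeasurable_fst (f : V -> R[i]) : cmeasurable f ->
  cmeasurable (fun z : V * V => f z.1).
Proof.
move=> [fr fi]; split.
  exact: (measurableT_comp fr measurable_fst).
exact: (measurableT_comp fi measurable_fst).
Qed.

Lemma cmeasurable_snd (f : V -> R[i]) : cmeasurable f ->
  cmeasurable (fun z : V * V => f z.2).
Proof.
move=> [fr fi]; split.
  exact: (measurableT_comp fr measurable_snd).
exact: (measurableT_comp fi measurable_snd).
Qed.

End ProductIntegral.

Section BoundedFunctions.
Context {d : measure_display} {T : measurableType d} {R : realType}.
Variable mu : probability T R.

Lemma ae_bounded_L2 (f : T -> R[i]) (C : R) : cmeasurable f ->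
  {ae mu, forall x, normc (f x) <= C} -> f \in L2pred mu.
Proof.
move=> mf fC; apply/L2pred_intP; split => //.
apply: (@le_lt_trans _ _ (\int[mu]_x (cst (C ^+ 2)%:E) x)%E); last first.
  rewrite integral_cst// [X in (_ * X)%E](_ : _ = 1%E) ?mule1 ?ltry//.
  exact: probability_setT.
apply: ae_ge0_le_integral => //.
- by move=> x _; rewrite lee_fin sqr_ge0.
- exact/measurable_EFinP/measurable_funX/measurable_normc.
- by move=> x _; rewrite lee_fin sqr_ge0.
- by apply: filterS fC => x fx _; rewrite lee_fin ler_sqr ?nnegrE ?(le_trans _ fx) ?normc_ge0.
Qed.

Lemma one_L2 : (cst 1 : T -> R[i]) \in L2pred mu.
Proof.
apply: (@ae_bounded_L2 _ 1); first exact: cmeasurable_cst.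
by apply: nearW => x; rewrite normc1.
Qed.

Definition oneL2 : L2 mu := L2class (MkL2fun one_L2).

Lemma oneL2E : {ae mu, forall x, oneL2 x = 1}.
Proof. exact: L2reprK. Qed.

End BoundedFunctions.

Section KernelOperators.
Context {d : measure_display} {V : measurableType d} {R : realType}.
Variable P : probability V R.
Implicit Types (M N : L2kernel P) (u v w : L2 P).

Lemma tensor_L2 u v : (fun z : V * V => u z.1 * (v z.2)^*) \in L2pred (P \x P)%E.
Proof.
apply/L2pred_intP; split.
  apply: cmeasurableM; first exact/cmeasurable_fst/L2_cmeasurable.
  exact/cmeasurable_conj/cmeasurable_snd/L2_cmeasurable.
pose a (x : V) := (normc (u x) ^+ 2)%:E; pose b (x : V) := (normc (v x) ^+ 2)%:E.
have ma : measurable_fun setT a.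
  exact/measurable_EFinP/measurable_funX/measurable_normc/L2_cmeasurable.
have mb : measurable_fun setT b.
  exact/measurable_EFinP/measurable_funX/measurable_normc/L2_cmeasurable.
have a0 x : (0 <= a x)%E by rewrite lee_fin sqr_ge0.
have b0 x : (0 <= b x)%E by rewrite lee_fin sqr_ge0.
rewrite (_ : (\int[_]_z _ = \int[(P \x P)%E]_z (a z.1 * b z.2))%E); last first.
  by apply: eq_integral => z _; rewrite -EFinM normcM normc_conj exprMn.
rewrite (fubini_tonelli1 (fun z => a z.1 * b z.2)%E)/=; last 2 first.
- apply: emeasurable_funM; first exact: (measurableT_comp ma measurable_fst).
  exact: (measurableT_comp mb measurable_snd).
- by move=> z; rewrite mule_ge0.
rewrite /fubini_F /=; under eq_integral do rewrite ge0_integralZl//.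
rewrite ge0_integralZr//; last exact: integral_ge0.
by rewrite lte_mul_pinfty ?integral_ge0 ?ge0_fin_numE ?integral_ge0 ?L2_sqr_lty.
Qed.

(* The kernel of the rank one operator [w |-> inner v w *: u]. *)
Definition tensor u v : L2kernel P := L2class (MkL2fun (tensor_L2 u v)).

Lemma tensorE u v :
  {ae (P \x P)%E, forall z, L2repr (tensor u v) z = u z.1 * (v z.2)^*}.
Proof. exact: L2reprK. Qed.

Lemma innerP u v : (forall w, inner w u = inner w v) -> u = v.
Proof.
move=> h; apply/eqP; rewrite -subr_eq0; apply/eqP/sqnorm_eq0/complexI.
by rewrite -inner_sqnorm innerBr h subrr.
Qed.

Lemma tensor_integrandE u v M : {ae (P \x P)%E, forall z,
  (L2repr (tensor u v) z)^* * L2repr M z = (u z.1)^* * (L2repr M z * v z.2)}.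
Proof.
have := tensorE u v; apply: filterS => z ->.
by rewrite conjcM conjCK -mulrA (mulrC (v _)).
Qed.

Lemma cmeasurable_tensor_integrand u v M :
  cmeasurable (fun z : V * V => (u z.1)^* * (L2repr M z * v z.2)).
Proof.
apply: cmeasurableM; first exact/cmeasurable_conj/cmeasurable_fst/L2_cmeasurable.
by apply: cmeasurableM; [|apply: cmeasurable_snd]; exact: L2_cmeasurable.
Qed.

Lemma cintegrable_tensor_integrand u v M :
  cintegrable (P \x P)%E (fun z => (u z.1)^* * (L2repr M z * v z.2)).
Proof.
apply: (@cintegrable_dom _ _ _ _ _
    (fun z => normc ((L2repr (tensor u v) z)^* * L2repr M z))).
- exact: cmeasurable_tensor_integrand.
- apply: cintegrable_normc; last exact: cintegrable_inner.
  exact: cmeasurable_inner.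
- by have := tensor_integrandE u v M; apply: filterS => z ->.
Qed.

Lemma inner_tensorE u v M : inner (tensor u v) M =
  cintegral (P \x P)%E (fun z => (u z.1)^* * (L2repr M z * v z.2)).
Proof.
apply: eq_ae_cintegral; first exact: cmeasurable_inner.
  exact: cmeasurable_tensor_integrand.
exact: tensor_integrandE.
Qed.

Lemma kactE M v : {ae P, forall x, kact M v x = kact_fun M v x}.
Proof. exact: L2reprK. Qed.

Lemma ae_cintegrable_kact M v :
  {ae P, forall x, cintegrable P (fun y => L2repr M (x, y) * v y)}.
Proof.
apply: (ae_cintegrable (f := fun z => L2repr M z * v z.2)).
(* Taking the constant 1 as the left factor reduces the claim to the integrability of a tensor
   integrand. *)
apply: (cintegrable_dom (g := fun z : V * V => normc
  ((oneL2 P z.1)^* * (L2repr M z * v z.2)))).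
- by apply: cmeasurableM; [|apply: cmeasurable_snd]; exact: L2_cmeasurable.
- apply: cintegrable_normc; last exact: cintegrable_tensor_integrand.
  exact: cmeasurable_tensor_integrand.
- have := ae_fst (oneL2E P); apply: filterS => z -> /=.
  by rewrite conjC1 mul1r.
Qed.

(** The bridge between the two sides: the coefficients of the operator are pairings in L_2(V x V),
    so weak convergence of kernels controls each of them. *)
Lemma inner_tensor u v M : inner (tensor u v) M = inner u (kact M v).
Proof.
rewrite inner_tensorE /inner; apply: cintegral_fubini.
- exact: cintegrable_tensor_integrand.
- exact: cmeasurable_inner.
- have := ae_cintegrable_kact M v; have := kactE M v.
  by apply: filterS2 => x -> iM; exact: (esym (cintegralZ (u x)^* iM)).
Qed.

Lemma inner_tensor2 u v u' v' :
  inner (tensor u v) (tensor u' v') = inner u u' * (inner v v')^*.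
Proof.
rewrite -innerC [in LHS]/inner.
transitivity (cintegral (P \x P)%E
    (fun z => ((v' z.2)^* * v z.2) * ((u z.1)^* * u' z.1))).
  apply: eq_ae_cintegral; first exact: (cmeasurable_inner (tensor u v) (tensor u' v')).
    exact: (cmeasurableM (cmeasurable_snd (cmeasurable_inner v' v))
      (cmeasurable_fst (cmeasurable_inner u u'))).
  have := tensorE u v; have := tensorE u' v'; apply: filterS2 => z -> ->.
  by rewrite conjcM conjCK; ring.
rewrite mulrC /inner -[in RHS]cintegralZ; last exact: cintegrable_inner.
apply: cintegral_fubini.
- apply: (@cintegrable_dom _ _ _ _ _
    (fun z => normc ((L2repr (tensor u v) z)^* * L2repr (tensor u' v') z))).
  + exact: (cmeasurableM (cmeasurable_snd (cmeasurable_inner v' v))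
      (cmeasurable_fst (cmeasurable_inner u u'))).
  + apply: cintegrable_normc; last exact: cintegrable_inner.
    exact: (cmeasurable_inner (tensor u v) (tensor u' v')).
  + have := tensorE u v; have := tensorE u' v'; apply: filterS2 => z -> ->.
    by rewrite !normcM !normc_conj normcM normc_conj; lra.
- by apply: cmeasurableM; [exact: cmeasurable_cst|exact: cmeasurable_inner].
- apply: nearW => x; rewrite mulrC -cintegralZ; last exact: cintegrable_inner.
  by congr cintegral; apply/funext => y /=; rewrite mulrC.
Qed.

Lemma L2norm_tensor u v : L2norm (tensor u v) = L2norm u * L2norm v.
Proof.
rewrite /L2norm -sqrtrM ?sqnorm_ge0//; congr Num.sqrt; apply: (@complexI R).
by rewrite realcM -!inner_sqnorm inner_tensor2 -innerC.
Qed.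

(** Tested against every [w], the identity becomes one between integrals over the product, where the
    exceptional null sets of the inner integrals play no part. *)
Lemma kactZDr M a u v : kact M (a *: u + v) = a *: kact M u + kact M v.
Proof.
apply: innerP => w; rewrite innerDr innerZr -!inner_tensor !inner_tensorE.
rewrite -cintegralZD; try exact: cintegrable_tensor_integrand.
apply: eq_ae_cintegral; first exact: cmeasurable_tensor_integrand.
  apply: cmeasurableD; last exact: cmeasurable_tensor_integrand.
  apply: cmeasurableM; first exact: cmeasurable_cst.
  exact: cmeasurable_tensor_integrand.
have := ae_snd (L2reprZ a u); have := ae_snd (L2reprD (a *: u) v).
by apply: filterS2 => z -> ->; ring.
Qed.

Lemma kactZDl a M N u : kact (a *: M + N) u = a *: kact M u + kact N u.
Proof.
apply: innerP => w.
by rewrite innerDr innerZr -!inner_tensor innerDr innerZr.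
Qed.

Lemma kactD M u v : kact M (u + v) = kact M u + kact M v.
Proof. by rewrite -[u]scale1r kactZDr !scale1r. Qed.

Lemma kact0 M : kact M 0 = 0.
Proof. by apply: (addrI (kact M 0)); rewrite -kactD !addr0. Qed.

Lemma kactZ M a u : kact M (a *: u) = a *: kact M u.
Proof. by rewrite -[a *: u]addr0 kactZDr kact0 addr0. Qed.

Lemma kactB M u v : kact M (u - v) = kact M u - kact M v.
Proof. by rewrite -scaleN1r kactD kactZ scaleN1r. Qed.

Lemma kactBl M N u : kact (M - N) u = kact M u - kact N u.
Proof. by rewrite addrC -scaleN1r kactZDl scaleN1r addrC. Qed.

Lemma kact_sum M n (a : 'I_n -> R[i]) (x : 'I_n -> L2 P) :
  kact M (\sum_i a i *: x i) = \sum_i a i *: kact M (x i).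
Proof.
elim/big_rec2 : _ => [|i y z _ <-]; first exact: kact0.
by rewrite kactD kactZ.
Qed.

Lemma kact_tensor u v w : kact (tensor u v) w = inner v w *: u.
Proof.
apply: innerP => w'.
by rewrite -inner_tensor inner_tensor2 innerZr mulrC -innerC.
Qed.

(** Cauchy-Schwarz in L_2(V x V) for [M] and [tensor (kact M v) v]: the operator norm is at most the
    Hilbert-Schmidt norm. *)
Lemma L2norm_kact M v : L2norm (kact M v) <= L2norm M * L2norm v.
Proof.
have [->|k0] := eqVneq (L2norm (kact M v)) 0.
  by rewrite mulr_ge0 ?L2norm_ge0.
have kp : 0 < L2norm (kact M v) by rewrite lt_def k0 L2norm_ge0.
rewrite -(ler_pM2l kp) -expr2 sqr_L2norm.
have := CauchySchwarz (tensor (kact M v) v) M.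
rewrite inner_tensor inner_sqnorm normc_real ger0_norm ?sqnorm_ge0//.
by rewrite L2norm_tensor mulrAC mulrA.
Qed.

Lemma cmeasurable_transpose (f : V * V -> R[i]) : cmeasurable f ->
  cmeasurable (fun z => f (z.2, z.1)).
Proof.
move=> [mr mi]; split.
  exact: (measurableT_comp mr (@measurable_swap _ _ _ _)).
exact: (measurableT_comp mi (@measurable_swap _ _ _ _)).
Qed.

Lemma adjoint_L2 M : (fun z => (L2repr M (z.2, z.1))^*) \in L2pred (P \x P)%E.
Proof.
have mM := L2_cmeasurable M; apply/L2pred_intP; split.
  exact/cmeasurable_conj/cmeasurable_transpose.
have := L2_sqr_lty M; rewrite -ge0_integral_swap; last 2 first.
- exact/measurable_EFinP/measurable_funX/measurable_normc.
- by move=> z; rewrite lee_fin sqr_ge0.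
by under [X in _ -> (X < _)%E]eq_integral do rewrite normc_conj.
Qed.

Definition adjoint M : L2kernel P := L2class (MkL2fun (adjoint_L2 M)).

Lemma self_adjointP M : self_adjoint M <-> adjoint M = M.
Proof.
have aE : {ae (P \x P)%E, forall z, L2repr (adjoint M) z = (L2repr M (z.2, z.1))^*}.
  exact: L2reprK.
split=> [sM|aM]; first by apply: L2_ext; apply: filterS2 aE sM => z -> ->.
by move: aE; rewrite aM.
Qed.

Lemma inner_tensor_adjoint u v M :
  inner (tensor u v) (adjoint M) = (inner (tensor v u) M)^*.
Proof.
rewrite !inner_tensorE -cintegral_conj; last exact: cintegrable_tensor_integrand.
have mI := cmeasurable_conj (cmeasurable_tensor_integrand v u M).
rewrite -[RHS]cintegral_swap//; apply: eq_ae_cintegral.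
- exact: cmeasurable_tensor_integrand.
- exact: (cmeasurable_transpose mI).
- have := L2reprK (MkL2fun (adjoint_L2 M)); apply: filterS => z /=.
  by rewrite -/(adjoint M) => ->; rewrite !conjcM !conjCK; ring.
Qed.

Lemma self_adjoint_kact M u v : self_adjoint M ->
  inner u (kact M v) = inner (kact M u) v.
Proof.
move=> /self_adjointP aM; rewrite (innerC v) -!inner_tensor -{1}aM.
exact: inner_tensor_adjoint.
Qed.

Lemma Linf_ball_L2 f : Linf_ball P f -> f \in L2pred P.
Proof. by move=> bf; have [mf _] := bf; apply: ae_bounded_L2 mf (Linf_ball_ae bf). Qed.

Definition Linf_L2 f (bf : Linf_ball P f) : L2 P := L2class (MkL2fun (Linf_ball_L2 bf)).

Lemma cut_formE f g (bf : Linf_ball P f) (bg : Linf_ball P g) M :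
  cut_form f M g = inner (Linf_L2 bf) (kact M (Linf_L2 bg)).
Proof.
rewrite -inner_tensor inner_tensorE; apply: eq_ae_cintegral.
- by apply: cut_integrand_measurable; [case: bf|case: bg].
- exact: cmeasurable_tensor_integrand.
- have := ae_fst (L2reprK (MkL2fun (Linf_ball_L2 bf))).
  have := ae_snd (L2reprK (MkL2fun (Linf_ball_L2 bg))).
  by apply: filterS2 => z -> ->; rewrite mulrA.
Qed.

End KernelOperators.

(** * Density of simple functions *)

Section Density.
Context {d : measure_display} {T : measurableType d} {R : realType}.
Variable mu : probability T R.
Implicit Types (u v w h : L2 mu) (A B : set T) (C : R).

Lemma L2repr_lincomb n (a : 'I_n -> R[i]) (x : 'I_n -> L2 mu) :
  {ae mu, forall t, L2repr (\sum_i a i *: x i) t = \sum_i a i * x i t}.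
Proof.
elim: n a x => [|n IH] a x.
  have := L2reprK (0 : L2fun mu); rewrite L2class0.
  by apply: filterS => t; rewrite !big_ord0.
have := L2reprD (a ord0 *: x ord0) (\sum_i a (lift ord0 i) *: x (lift ord0 i)).
have := L2reprZ (a ord0) (x ord0).
have := IH (fun i => a (lift ord0 i)) (fun i => x (lift ord0 i)).
by apply: filterS3 => t IHt Zt Dt; rewrite !big_ord_recl Dt Zt IHt.
Qed.

Lemma L2reprB u v : {ae mu, forall x, L2repr (u - v) x = u x - v x}.
Proof.
have := L2reprD u (- v); have := L2reprZ (-1) v.
by rewrite scaleN1r; apply: filterS2 => x Nx ->; rewrite Nx mulN1r.
Qed.

Lemma L2pred_dom (f : T -> R[i]) u : cmeasurable f ->
  (forall x, normc (f x) <= normc (u x)) -> f \in L2pred mu.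
Proof.
move=> mf fu; apply/L2pred_intP; split => //.
apply: le_lt_trans (L2_sqr_lty u); apply: ge0_le_integral => //.
- by move=> x _; rewrite lee_fin sqr_ge0.
- exact/measurable_EFinP/measurable_funX/measurable_normc.
- exact/measurable_EFinP/measurable_funX/measurable_normc/L2_cmeasurable.
- by move=> x _; rewrite lee_fin ler_sqr ?nnegrE ?normc_ge0.
Qed.

Lemma cmeasurable_real (f : T -> R) : measurable_fun setT f ->
  cmeasurable (fun x => (f x)%:C).
Proof. by move=> mf; split => //=; exact: measurable_cst. Qed.

Definition cindic A (x : T) : R[i] := (\1_A x)%:C.

Lemma cmeasurable_cindic A : measurable A -> cmeasurable (cindic A).
Proof. by move=> mA; apply: cmeasurable_real; exact: measurable_indic. Qed.

Lemma normc_cindic A x : normc (cindic A x) = \1_A x.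
Proof. by rewrite normc_real ger0_norm// indicE. Qed.

Lemma cindic_L2 A : measurable A -> cindic A \in L2pred mu.
Proof.
move=> mA; apply: (@ae_bounded_L2 _ _ _ _ _ 1); first exact: cmeasurable_cindic.
by apply: nearW => x; rewrite normc_cindic indicE lern1; case: (x \in A).
Qed.

Definition indicL2 A (mA : measurable A) : L2 mu := L2class (MkL2fun (cindic_L2 mA)).

Lemma indicL2E A (mA : measurable A) :
  {ae mu, forall x, indicL2 mA x = (\1_A x)%:C}.
Proof. exact: L2reprK. Qed.

Definition L2closed (S : set (L2 mu)) :=
  forall u, (forall e, 0 < e -> exists2 v, S v & L2norm (u - v) < e) -> S u.

Section ClosedSubspace.
Variable S : set (L2 mu).
Hypotheses (sS : subspace S) (cS : L2closed S).
Hypothesis indS : forall A (mA : measurable A), S (indicL2 mA).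

Import HBSimple HBNNSimple.

(** Simple functions increasing to [f] converge to it in L_2, because [f ^+ 2] dominates the squared
    errors. *)
Let nonneg_dense (f : T -> R) (fL : (fun x => (f x)%:C) \in L2pred mu) :
  (forall x, 0 <= f x) -> S (L2class (MkL2fun fL)).
Proof.
move=> f0; have /L2pred_intP[[mf _] fL2] := fL.
rewrite -/f in mf; apply: cS => e e0.
have mf' : measurable_fun setT (EFin \o f) by exact/measurable_EFinP.
pose g n : {nnsfun T >-> R} := nnsfun_approx measurableT mf' n.
have gf x : (fun n => g n x) @ \oo --> f x.
  have : EFin \o (fun n => g n x) @ \oo --> (f x)%:E.
    by apply: (cvg_nnsfun_approx measurableT mf') => // y _; rewrite lee_fin.
  by move=> /fine_cvgP[_].
have gle n x : g n x <= f x.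
  have nd : nondecreasing_seq (fun n => g n x).
    move=> m k mk; have := nd_nnsfun_approx measurableT mf' mk.
    by move=> /lefP; exact.
  have := nondecreasing_cvgn_le nd (cvgP _ (gf x)) n.
  by rewrite (cvg_lim _ (gf x)).
have mg n : measurable_fun setT (g n) by exact: measurable_funP.
pose u := L2class (MkL2fun fL).
have uE : {ae mu, forall x, u x = (f x)%:C} by exact: L2reprK.
have [v [vS vE]] : exists v : nat -> L2 mu, (forall n, S (v n)) /\
    forall n, {ae mu, forall x, v n x = (g n x)%:C}.
  have /choice[v vP] : forall n, exists v, S v /\ {ae mu, forall x, v x = (g n x)%:C}.
    move=> n.
    have [k [a [A [mA gE]]]] : exists k (a : 'I_k -> R) (A : 'I_k -> set T),
        (forall i, measurable (A i)) /\ forall x, g n x = \sum_i a i * \1_(A i) x.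
      eexists _, _, _; split; last exact: fimfunEord.
      by move=> i; exact: measurable_sfunP.
    exists (\sum_i (a i)%:C *: indicL2 (mA i)); split; first exact: subspace_sum.
    have := L2repr_lincomb (fun i => (a i)%:C) (fun i => indicL2 (mA i)).
    have : {ae mu, forall x, forall i, indicL2 (mA i) x = (\1_(A i) x)%:C}.
      by apply: filter_forall => i; exact: indicL2E.
    apply: filterS2 => x iE ->; rewrite gE rmorph_sum /=; apply: eq_bigr => i _.
    by rewrite iE -realcM.
  by exists v; split=> n; have [] := vP n.
have ifsq : mu.-integrable setT (EFin \o (fun x => f x ^+ 2)).
  apply/integrableP; split.
    exact/measurable_EFinP/measurable_funX.
  apply: le_lt_trans fL2; rewrite le_eqVlt; apply/orP; left; apply/eqP.
  apply: eq_integral => x _.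
  by rewrite normc_real real_normK ?num_real//= ger0_norm ?sqr_ge0.
have mD n : measurable_fun setT (fun x => ((f x - g n x) ^+ 2)%:E).
  by apply/measurable_EFinP/measurable_funX/measurable_funB.
have cvD : {ae mu, forall x, setT x ->
    (fun n => ((f x - g n x) ^+ 2)%:E) @ \oo --> cst (0%:E : \bar R) x}.
  apply: nearW => x _; apply: cvg_EFin; first exact: nearW.
  rewrite -[X in _ --> X](mulr0 0) -(subrr (f x)).
  under eq_fun do rewrite /= expr2.
  by apply: cvgM; exact: cvgB (cvg_cst _) (gf x).
have leD : {ae mu, forall x n, setT x ->
    (`|((f x - g n x) ^+ 2)%:E| <= (f x ^+ 2)%:E)%E}.
  apply: nearW => x n _ /=; rewrite lee_fin ger0_norm ?sqr_ge0//.
  by rewrite ler_sqr ?nnegrE ?subr_ge0// gerBl; exact: fun_ge0.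
have [_ _] := dominated_convergence measurableT mD (measurable_cst _) cvD ifsq leD.
rewrite integral0 => /fine_cvgP[_] /cvgr0Pnorm_lt /(_ (e ^+ 2)).
rewrite exprn_gt0// => /(_ isT)[n _ /(_ n (leqnn _))] /= ne.
exists (v n) => //.
rewrite -(@ltr_pXn2r _ 2)// ?nnegrE ?L2norm_ge0 ?ltW// sqr_L2norm.
apply: le_lt_trans ne; apply: le_trans (ler_norm _); rewrite /sqnorm /Rintegral.
rewrite le_eqVlt; apply/orP; left; apply/eqP; congr fine; apply: ae_eq_integral => //.
- exact/measurable_EFinP/measurable_funX/measurable_normc/L2_cmeasurable.
- have := L2reprB u (v n); have := vE n; have := uE.
  apply: filterS3 => x /= -> -> -> _; rewrite -realcB normc_real.
  by rewrite real_normK ?num_real.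
Qed.

(** Positive and negative parts are treated separately; both are dominated by [u], hence square
    integrable. *)
Let real_dense u (f : T -> R) : measurable_fun setT f ->
  (forall x, `|f x| <= normc (u x)) ->
  exists2 v, S v & {ae mu, forall x, v x = (f x)%:C}.
Proof.
move=> mf fu.
have H (g : T -> R) : measurable_fun setT g -> (forall x, 0 <= g x <= `|f x|) ->
    exists2 v, S v & {ae mu, forall x, v x = (g x)%:C}.
  move=> mg gf.
  have gL : (fun x => (g x)%:C) \in L2pred mu.
    apply: (@L2pred_dom _ u); first exact: cmeasurable_real.
    move=> x; have /andP[g0 gfx] := gf x.
    by rewrite normc_real ger0_norm// (le_trans gfx).
  exists (L2class (MkL2fun gL)); last exact: L2reprK.
  by apply: nonneg_dense => x; have /andP[] := gf x.
have [||v Sv vE] := H (fun x => Num.max (f x) 0).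
- exact: measurable_maxr.
- move=> x; rewrite le_max lexx orbT /=.
  by case: (leP (f x) 0) => h; rewrite ?normr_ge0 ?ler_norm.
have [||w Sw wE] := H (fun x => Num.max (- f x) 0).
- by apply: measurable_maxr => //; exact: measurable_funN.
- move=> x; rewrite le_max lexx orbT /=.
  by case: (leP (- f x) 0) => h; rewrite ?normr_ge0// -normrN ler_norm.
exists (v - w); first exact: subspaceB.
have := L2reprB v w; move: vE wE; apply: filterS3 => x -> -> ->.
rewrite -realcB; congr _%:C.
by case: (leP (f x) 0) => h; case: (leP (- f x) 0) => h'; lra.
Qed.

Lemma indic_dense u : S u.
Proof.
have [mr mi] := L2_cmeasurable u.
have [|v Sv vE] := real_dense mr (u := u).
  by move=> x; have [] := normc_ge_ReIm (u x).
have [|w Sw wE] := real_dense mi (u := u).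
  by move=> x; have [] := normc_ge_ReIm (u x).
suff -> : u = 'i%C *: w + v by have [_ SS] := sS; exact: SS.
apply: L2_ext; have := L2reprD ('i%C *: w) v; have := L2reprZ 'i%C w.
move=> Zx Dx; apply: filterS3 vE wE (filterI Zx Dx) => x vx wx [Zx' Dx'].
by rewrite Dx' Zx' vx wx addrC -complexE.
Qed.

End ClosedSubspace.

End Density.

(** * Bounded functions and weak limits *)

Section BoundedFunctionsInL2.
Context {d : measure_display} {T : measurableType d} {R : realType}.
Variable mu : probability T R.
Implicit Types (u v w h : L2 mu) (A B : set T) (C : R).

Definition L1norm u : R := \int[mu]_x normc (u x).

Lemma L1norm_ge0 u : 0 <= L1norm u.
Proof. by apply: Rintegral_ge0 => x _; exact: normc_ge0. Qed.

Lemma le_Rintegral_ae (f g : T -> R) : measurable_fun setT f ->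
  mu.-integrable setT (EFin \o g) -> (forall x, 0 <= f x) ->
  {ae mu, forall x, f x <= g x} -> \int[mu]_x f x <= \int[mu]_x g x.
Proof.
move=> mf ig f0 fg.
have mg := measurable_int _ ig.
have fg' : (\int[mu]_x (f x)%:E <= \int[mu]_x (`|g x|)%:E)%E.
  apply: ae_ge0_le_integral => //.
  - by move=> x _; rewrite lee_fin.
  - exact/measurable_EFinP.
  - by apply/measurable_EFinP/measurableT_comp => //; exact/measurable_EFinP.
  - by apply: filterS fg => x fg _; rewrite lee_fin (le_trans fg)// ler_norm.
(* [g] is nonnegative only almost everywhere, hence the detour through its absolute value. *)
have gE : (\int[mu]_x (g x)%:E = \int[mu]_x (`|g x|)%:E)%E.
  apply: ae_eq_integral => //.
    by apply/measurable_EFinP/measurableT_comp => //; exact/measurable_EFinP.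
  by apply: filterS fg => x fg _; rewrite ger0_norm// (le_trans _ fg).
rewrite /Rintegral; apply: fine_le; rewrite ?gE//.
- have ifi : mu.-integrable setT (EFin \o f).
    apply/integrableP; split; first exact/measurable_EFinP.
    have /integrableP[_] := ig; apply: le_lt_trans.
    rewrite (_ : \int[mu]_x `|_| = \int[mu]_x (f x)%:E)%E.
      exact: fg'.
    by apply: eq_integral => x _ /=; rewrite ger0_norm.
  exact: integrable_fin_num ifi.
- by rewrite -gE; exact: integrable_fin_num ig.
Qed.

Lemma integrable_L2 u : mu.-integrable setT (EFin \o (fun x => normc (u x))).
Proof.
apply: (@le_integrable _ _ _ mu _ measurableT _
   (fun x => (1 + normc (u x) ^+ 2)%:E)).
- exact/measurable_EFinP/measurable_normc/L2_cmeasurable.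
- move=> x _ /=; rewrite lee_fin [leLHS]ger0_norm ?normc_ge0//.
  by rewrite [leRHS]ger0_norm ?addr_ge0 ?sqr_ge0//; have := normc_ge0 (u x); nra.
- under eq_fun do rewrite EFinD.
  apply: integrableD => //; last exact: integrable_sqr_L2.
  exact: finite_measure_integrable_cst.
Qed.

Lemma le_inner_ae_bounded u h C : {ae mu, forall x, normc (u x) <= C} ->
  normc (inner h u) <= C * L1norm h.
Proof.
move=> uC; have ih := integrable_L2 h.
apply: le_trans (le_normc_cintegral _ _) _.
- exact: cmeasurable_inner.
- exact: cintegrable_inner.
rewrite -RintegralZl//; apply: le_Rintegral_ae.
- exact/measurable_normc/cmeasurable_inner.
- rewrite [X in integrable _ _ X](_ : _ = (fun x => C%:E * (normc (h x))%:E)%E)//.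
  exact: integrableZl.
- by move=> x; exact: normc_ge0.
- apply: filterS uC => x uC.
  by rewrite normcM normc_conj mulrC ler_wpM2r// normc_ge0.
Qed.

Lemma Rintegral_probability_cst C : \int[mu]_x (cst C x) = C.
Proof.
rewrite Rintegral_cst// [X in _ * fine X](_ : _ = 1%E) ?mulr1//.
exact: probability_setT.
Qed.

Lemma L2norm_ae_bounded u C : 0 <= C -> {ae mu, forall x, normc (u x) <= C} ->
  L2norm u <= C.
Proof.
move=> C0 uC; rewrite -(@ler_pXn2r _ 2)// ?nnegrE ?L2norm_ge0// sqr_L2norm.
have <- : \int[mu]_x (cst (C ^+ 2) x) = C ^+ 2.
  exact: Rintegral_probability_cst.
apply: le_Rintegral_ae.
- exact/measurable_funX/measurable_normc/L2_cmeasurable.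
- exact: finite_measure_integrable_cst.
- by move=> x; exact: sqr_ge0.
- by apply: filterS uC => x uC; rewrite ler_sqr ?nnegrE ?normc_ge0.
Qed.

(** Integrate [t <= 1 + t^2] over a space of mass 1. This is the origin of the factor 2 in
    [ae_bounded_kact]. *)
Lemma L1norm_le u : L2norm u <= 1 -> L1norm u <= 2.
Proof.
move=> u1; have <- : 1 + sqnorm u + (1 - sqnorm u) = 2 by ring.
apply: (@le_trans _ _ (1 + sqnorm u)); last first.
  by rewrite lerDl subr_ge0 -sqr_L2norm expr_le1// L2norm_ge0.
have {1}<- : \int[mu]_x (cst 1 x) = 1.
  exact: Rintegral_probability_cst.
rewrite /sqnorm -RintegralD//; last 2 first.
- exact: finite_measure_integrable_cst.
- exact: integrable_sqr_L2.
apply: le_Rintegral_ae.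
- exact/measurable_normc/L2_cmeasurable.
- rewrite [X in integrable _ _ X](_ : _ =
    (fun x => (cst 1 x)%:E + (normc (u x) ^+ 2)%:E)%E)//.
  apply: integrableD => //; last exact: integrable_sqr_L2.
  exact: finite_measure_integrable_cst.
- by move=> x; exact: normc_ge0.
- by apply: nearW => x /=; have := normc_ge0 (u x); nra.
Qed.

Lemma Rintegral_le0_ae (f : T -> R) : mu.-integrable setT (EFin \o f) ->
  (forall x, 0 <= f x) -> \int[mu]_x f x <= 0 -> {ae mu, forall x, f x = 0}.
Proof.
move=> fi f0 fle.
have f00 : \int[mu]_x f x = 0.
  by apply/eqP; rewrite eq_le fle/=; apply: Rintegral_ge0.
have : (\int[mu]_x `|(f x)%:E| = 0)%E.
  have /fineK E := integrable_fin_num measurableT fi.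
  have {}E := etrans (congr1 EFin (esym f00)) E.
  apply: etrans (esym E).
  by apply: eq_integral => x _ /=; rewrite ger0_norm.
move/(ae_eq_integral_abs mu measurableT (measurable_int _ fi)).
by apply: filterS => x /(_ I) [].
Qed.

Lemma cLnorm_leP (f : T -> R[i]) C :
  (cLnorm mu +oo f <= C%:E)%E <-> {ae mu, forall x, normc (f x) <= C}.
Proof.
have mu0 : (0 < mu setT)%E.
  by rewrite (_ : mu setT = 1%E) ?lte01//; exact: probability_setT.
rewrite /cLnorm unlock /= mu0; split.
  move/ess_supP; apply: filterS => x /=.
  by rewrite lee_fin ger0_norm// normc_ge0.
move=> h; apply/ess_supP; apply: filterS h => x /=.
by rewrite lee_fin ger0_norm// normc_ge0.
Qed.

(** Duality with L_1. For [h] the restriction of [u] to the set where |u| exceeds [C], the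
    hypothesis says that the integral of |u| (|u| - C) over that set is at most 0, while the
    integrand is positive there. *)
Lemma ae_bounded_inner u C : 0 <= C ->
  (forall h, normc (inner h u) <= C * L1norm h) ->
  {ae mu, forall x, normc (u x) <= C}.
Proof.
move=> C0 hC; pose A := [set x | C < normc (u x)].
have mnu := measurable_normc (L2_cmeasurable u).
have mA : measurable A.
  have mnu' : measurable_fun setT (EFin \o (fun x => normc (u x))).
    exact/measurable_EFinP.
  have := emeasurable_fun_o_infty measurableT mnu' C%:E; rewrite setTI.
  by under eq_set do rewrite lte_fin.
have hL : (fun x => (\1_A x)%:C * u x) \in L2pred mu.
  apply: (L2pred_dom (u := u)).
    by apply: cmeasurableM; [exact: cmeasurable_cindic|exact: L2_cmeasurable].
  by move=> x; rewrite normcM normc_cindic ler_piMl ?normc_ge0.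
pose h := L2class (MkL2fun hL).
have hE : {ae mu, forall x, h x = (\1_A x)%:C * u x} by exact: L2reprK.
have m1 : measurable_fun setT (\1_A : T -> R) by exact: measurable_indic.
have i1 : mu.-integrable setT (EFin \o (fun x => \1_A x * normc (u x))).
  apply: (le_integrable measurableT _ _ (integrable_L2 u)).
    exact/measurable_EFinP/measurable_funM.
  move=> x _ /=; rewrite lee_fin normrM ler_piMl// indicE.
  by rewrite ger0_norm// lern1; case: (x \in A).
have i2 : mu.-integrable setT (EFin \o (fun x => \1_A x * normc (u x) ^+ 2)).
  apply: (le_integrable measurableT _ _ (integrable_sqr_L2 u)).
    exact/measurable_EFinP/measurable_funM/measurable_funX.
  move=> x _ /=; rewrite lee_fin normrM ler_piMl// indicE.
  by rewrite ger0_norm// lern1; case: (x \in A).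
pose f x := \1_A x * normc (u x) ^+ 2 - C * (\1_A x * normc (u x)).
have iC : mu.-integrable setT (EFin \o (fun x => C * (\1_A x * normc (u x)))).
  rewrite [X in integrable _ _ X](_ : _ =
    (fun x => C%:E * (\1_A x * normc (u x))%:E)%E)//.
  exact: integrableZl.
have f_gt0 x : A x -> 0 < f x.
  rewrite /A/= => Cu; rewrite /f indicE mem_set// !mul1r expr2 -mulrBl.
  by rewrite mulr_gt0 ?subr_gt0// (le_lt_trans C0).
have f0 x : ~ A x -> f x = 0.
  by move=> nA; rewrite /f indicE memNset// !mul0r mulr0 subrr.
have : {ae mu, forall x, f x = 0}.
  apply: Rintegral_le0_ae.
  - rewrite [X in integrable _ _ X](_ : _ = (fun x => (\1_A x * normc (u x) ^+ 2)%:E -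
       (C * (\1_A x * normc (u x)))%:E)%E)//.
    exact: integrableB.
  - by move=> x; have [/f_gt0/ltW//|/f0->] := pselect (A x).
  rewrite RintegralB// subr_le0 RintegralZl//.
  have -> : \int[mu]_x (\1_A x * normc (u x) ^+ 2) = Re (inner h u).
    rewrite (_ : inner h u = cintegral mu (fun x => (\1_A x * normc (u x) ^+ 2)%:C))//.
    apply: eq_ae_cintegral; first exact: cmeasurable_inner.
      by apply: cmeasurable_real; exact/measurable_funM/measurable_funX.
    apply: filterS hE => x ->.
    by rewrite conjcM conj_real -mulrA mul_conjc -realcM.
  apply: le_trans (Re_le_normc _) _; apply: le_trans (hC h) _.
  rewrite ler_wpM2l//; apply: le_Rintegral_ae => //.
  - exact/measurable_normc/L2_cmeasurable.
  - by move=> x; exact: normc_ge0.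
  - by apply: filterS hE => x ->; rewrite normcM normc_cindic.
apply: filterS => x fx0; rewrite leNgt; apply/negP => /f_gt0.
by rewrite fx0 ltxx.
Qed.

Lemma ae_le_density (g : T -> R) C : mu.-integrable setT (EFin \o g) ->
  (forall A, measurable A -> \int[mu]_(x in A) g x <= C * fine (mu A)) ->
  {ae mu, forall x, g x <= C}.
Proof.
move=> ig gC; pose A := [set x | C < g x].
have mA : measurable A.
  have := emeasurable_fun_o_infty measurableT (measurable_int _ ig) C%:E.
  by rewrite setTI; under eq_set do rewrite /= lte_fin.
have igC : mu.-integrable setT (EFin \o (fun x => g x - C)).
  rewrite [X in integrable _ _ X](_ : _ = (fun x => (g x)%:E - (cst C x)%:E)%E)//.
  by apply: integrableB => //; exact: finite_measure_integrable_cst.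
pose f := (fun x => g x - C) \_ A.
have f_gt0 x : A x -> 0 < f x by move=> Ax; rewrite /f patchE mem_set// subr_gt0.
have f0 x : ~ A x -> f x = 0 by move=> nA; rewrite /f patchE memNset.
have igA : mu.-integrable A (EFin \o (fun x => g x - C)).
  exact: integrableS igC.
have : {ae mu, forall x, f x = 0}.
  apply: Rintegral_le0_ae.
  - by rewrite -restrict_EFin; apply/(integrable_mkcond _ mA).
  - by move=> x; have [/f_gt0/ltW//|/f0->] := pselect (A x).
  rewrite -Rintegral_mkcond RintegralB//; last 2 first.
  - exact: integrableS ig.
  - by apply: (@integrableS _ _ _ mu setT) => //; exact: finite_measure_integrable_cst.
  by rewrite Rintegral_cst// subr_le0 gC.
apply: filterS => x fx0; rewrite leNgt; apply/negP => /f_gt0.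
by rewrite fx0 ltxx.
Qed.

End BoundedFunctionsInL2.

(** * Radon-Nikodym densities of set functions dominated by the measure *)

Section DensityOfBoundedCharges.
Context {d : measure_display} {T : measurableType d} {R : realType}.
Variable mu : probability T R.
Variables (L : set T -> R) (C : R).
Hypothesis C0 : 0 <= C.
Hypothesis Lbnd : forall A, measurable A -> `|L A| <= C * fine (mu A).
Hypothesis LD : forall A B, measurable A -> measurable B -> A `&` B = set0 ->
  L (A `|` B) = L A + L B.

Let tail (F : (set T)^nat) n := \bigcup_(i in [set i | (n <= i)%N]) F i.

(** Stated for any additive [K], so as to serve both for [L] and for the measure. *)
Let additive_tail (K : set T -> R) (F : (set T)^nat) :
  (forall A B, measurable A -> measurable B -> A `&` B = set0 ->
    K (A `|` B) = K A + K B) ->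
  (forall i, measurable (F i)) -> trivIset setT F ->
  forall n, K (\bigcup_n F n) = \sum_(0 <= i < n) K (F i) + K (tail F n).
Proof.
move=> KD mF tF; elim=> [|n IH].
  rewrite big_geq// add0r; congr K; apply/seteqP; split=> x [i _ Fx];
  by exists i.
rewrite big_nat_recr//= IH -addrA; congr (_ + _).
rewrite -KD//.
- congr K; apply/seteqP; split=> x.
    move=> [i /=]; rewrite leq_eqVlt => /orP[/eqP <-|ni] Fx; [by left|right].
    by exists i.
  by move=> [Fx|[i /= ni Fx]]; [exists n => /=|exists i => //=; exact: ltnW].
- by apply: bigcup_measurable => i _.
- apply/seteqP; split=> // x [Fnx [i /= ni Fix]].
  have nE := tF n i I I (ex_intro _ x (conj Fnx Fix)).
  by rewrite nE ltnn in ni.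
Qed.

Let mfin A : measurable A -> mu A = (fine (mu A))%:E.
Proof. by move=> mA; rewrite fineK// fin_num_measure. Qed.

Let nu (A : set T) : \bar R := (L A)%:E.

(** The remainder after [n] terms is [L] of a tail of the union. It is at most [C] times the measure
    of that tail, which tends to 0. *)
Let nu_sigma_additive : semi_sigma_additive nu.
Proof.
move=> F mF tF mUF; rewrite /nu; under eq_fun do rewrite sumEFin.
apply: cvg_EFin; first exact: nearW.
have msum : (fun n => \sum_(0 <= i < n) fine (mu (F i))) @ \oo -->
    fine (mu (\bigcup_n F n)).
  suff : (fun n => (\sum_(0 <= i < n) fine (mu (F i)))%:E) @ \oo -->
      (fine (mu (\bigcup_n F n)))%:E by move=> /fine_cvgP[_].
  rewrite -mfin// (_ : (fun _ => _) = (fun n => \sum_(0 <= i < n) mu (F i))%E).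
    exact: (@measure_semi_sigma_additive _ _ _ mu F mF tF mUF).
  apply/funext => n; rewrite -sumEFin; apply: eq_bigr => i _.
  exact/esym/mfin.
have mD A B : measurable A -> measurable B -> A `&` B = set0 ->
    fine (mu (A `|` B)) = fine (mu A) + fine (mu B).
  by move=> mA mB AB; rewrite measureU// fineD// ?fin_num_measure.
have mt n : measurable (tail F n) by apply: bigcup_measurable => i _.
apply/cvgrPdist_le => e e0.
(* [C] may be 0, hence the [C + 1]. *)
have e0' : 0 < e / (C + 1) by rewrite divr_gt0// ltr_wpDl.
move/cvgrPdist_le : msum => /(_ _ e0'); apply: filterS => n /=.
rewrite (additive_tail mD mF tF n) (additive_tail LD mF tF n).
rewrite addrAC subrr add0r addrAC subrr add0r.
rewrite ger0_norm ?fine_ge0// => h; apply: le_trans (Lbnd (mt n)) _.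
rewrite ler_pdivlMr ?ltr_wpDl// in h.
apply: le_trans h; rewrite mulrC ler_wpM2l ?fine_ge0//.
by rewrite lerDl.
Qed.

Let nu0 : nu set0 = 0%E.
Proof.
congr EFin; apply/eqP; rewrite -normr_le0; apply: le_trans (Lbnd _) _ => //.
by rewrite measure0 mulr0.
Qed.

(** Domination by [mu] supplies what finite additivity lacks: sigma-additivity and absolute
    continuity. It also bounds the density, by comparison on the sets where [g] or [- g] exceeds
    [C]. *)
Lemma bounded_charge_density : exists g : T -> R,
  [/\ measurable_fun setT g, {ae mu, forall x, `|g x| <= C} &
      forall A, measurable A -> L A = \int[mu]_(x in A) g x].
Proof.
pose nuC : charge T R :=
  HB.pack nu (isCharge.Build _ _ _ nu nu0 (fun _ _ => erefl) nu_sigma_additive).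
have dom : nuC `<< mu.
  apply/null_content_dominatesP => A mA /= muA0; rewrite /nu; congr EFin.
  apply/eqP; rewrite -normr_le0; apply: le_trans (Lbnd mA) _.
  by rewrite muA0 mulr0.
pose f := Radon_Nikodym nuC mu.
have fE x : f x = (fine (f x))%:E by rewrite fineK// Radon_Nikodym_fin_num.
pose g x := fine (f x).
have fg : f = EFin \o g by apply/funext.
have ig : mu.-integrable setT (EFin \o g).
  by rewrite -fg; exact: Radon_Nikodym_integrable.
have LE A : measurable A -> L A = \int[mu]_(x in A) g x.
  move=> mA; have := Radon_Nikodym_integral dom mA.
  by rewrite -/f fg /Rintegral => <-.
have iN : mu.-integrable setT (EFin \o (fun x => - g x)).
  rewrite [X in integrable _ _ X](_ : _ = (fun x => - (g x)%:E)%E)//.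
  exact: integrableN.
exists g; split => //; first by apply/measurable_EFinP; exact: measurable_int ig.
have h1 : {ae mu, forall x, g x <= C}.
  apply: ae_le_density => // A mA; rewrite -LE//.
  exact: le_trans (ler_norm _) (Lbnd mA).
have h2 : {ae mu, forall x, - g x <= C}.
  apply: ae_le_density => // A mA.
  under eq_Rintegral do rewrite -mulN1r.
  rewrite RintegralZl//; last exact: integrableS ig.
  by rewrite mulN1r -LE//; apply: le_trans (Lbnd mA); rewrite -normrN ler_norm.
apply: filterS2 h1 h2 => x h1 h2; rewrite ler_norml h1 andbT.
by rewrite lerNl.
Qed.

End DensityOfBoundedCharges.

(** * Limits along filters and ultrafilters *)

Section UltrafilterLimits.
Context {R : realType} {X : Type}.

(** The compact segment provides a cluster point, and an ultrafilter converges to each of its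
    cluster points. *)
Lemma ultra_cvg_bounded (U : set_system X) {UU : UltraFilter U} (f : X -> R) (C : R) :
  U [set x | `|f x| <= C] -> exists l : R, f @ U --> l.
Proof.
move=> fC; have fI : U (f @^-1` `[- C, C]%classic).
  by apply: filterS fC => x; rewrite /= in_itv /= -ler_norml.
have [l [_ ll]] := @segment_compact R (- C) C (f @ U) _ fI.
exists l => A lA; have [//|nA] := in_ultra_setVsetC (f @^-1` A) UU.
by have [y [/=]] := ll (~` A) A nA lA.
Qed.

Lemma cvg_le_bound (U : set_system X) {UU : ProperFilter U} (f : X -> R) (l a : R) :
  f @ U --> l -> U [set x | f x <= a] -> l <= a.
Proof.
move=> fl fa; rewrite leNgt; apply/negP => al.
have e0 : 0 < l - a by rewrite subr_gt0.
move/cvgrPdist_lt : fl => /(_ _ e0) fl.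
have [x [/=]] := filter_ex (filterI fl fa).
move=> h1 h2; have := le_lt_trans (ler_norm _) h1; lra.
Qed.

End UltrafilterLimits.

Section WeakConvergence.
Context {d : measure_display} {T : measurableType d} {R : realType}.
Variable mu : {measure set T -> \bar R}.
Implicit Types (F : set_system (L2 mu)) (u v w h : L2 mu).

(** Weak convergence against a single test vector [h], so that the good test vectors form a set to
    which density arguments apply. *)
Definition pairing_cvg F w h :=
  forall e : R, 0 < e -> F [set u | normc (inner h u - inner h w) < e].

Lemma subspace_pairing_cvg F {FF : Filter F} w : subspace (pairing_cvg F w).
Proof.
split=> [e e0|a h k hh hk e e0].
  by apply: nearW => u; rewrite /mkset !inner0l subrr normc0.
pose e1 := e / 2 / (normc a + 1).
have a1 : 0 < normc a + 1 by rewrite ltr_wpDl ?normc_ge0.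
have e10 : 0 < e1 by rewrite !divr_gt0.
have e20 : 0 < e / 2 by rewrite divr_gt0.
have := hk _ e20; have := hh _ e10; apply: filterS2 => u; rewrite /mkset => h1 h2.
rewrite !innerDl !innerZl opprD addrACA -mulrBr.
apply: le_lt_trans (le_normcD _ _) _; rewrite normcM normc_conj.
rewrite [ltRHS](splitr e) ler_ltD//.
apply: (@le_trans _ _ (normc a * e1)); first by rewrite ler_wpM2l ?normc_ge0// ltW.
rewrite /e1 mulrCA ler_piMr ?(ltW e20)//.
by rewrite ler_pdivrMr// mul1r lerDl.
Qed.

(** Replacing [h] by a close [k] costs at most the norm of [h - k] times that of [u - w], and the
    latter is eventually at most [C + L2norm w]. *)
Lemma L2closed_pairing_cvg F {FF : Filter F} w C : 0 <= C ->
  F [set u | L2norm u <= C] ->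
  forall h, (forall e, 0 < e ->
    exists2 k, pairing_cvg F w k & L2norm (h - k) < e) -> pairing_cvg F w h.
Proof.
move=> C0 FC h hcl e e0.
pose D := C + L2norm w + 1.
have D0 : 0 < D by rewrite ltr_wpDl ?addr_ge0 ?L2norm_ge0.
have e20 : 0 < e / 2 by rewrite divr_gt0.
have [k kF hk] := hcl _ (divr_gt0 e20 D0).
apply: filterS2 (kF _ e20) FC => u; rewrite /mkset => ku uC.
have -> : inner h u - inner h w = (inner k u - inner k w) + inner (h - k) (u - w).
  by rewrite innerBl !innerBr; ring.
apply: le_lt_trans (le_normcD _ _) _; rewrite [ltRHS](splitr e) ltr_leD//.
apply: le_trans (CauchySchwarz _ _) _.
rewrite ltr_pdivlMr// in hk; apply: le_trans (ltW hk).
rewrite ler_wpM2l ?L2norm_ge0//; apply: le_trans (L2normB _ _) _.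
by rewrite /D ler_wpDr// lerD2r.
Qed.

End WeakConvergence.

Section WeakLimit.
Context {d : measure_display} {T : measurableType d} {R : realType}.
Variable mu : probability T R.
Implicit Types (u v w h : L2 mu).

Lemma L1norm_indicL2 A (mA : measurable A) : L1norm (indicL2 mu mA) <= fine (mu A).
Proof.
have -> : fine (mu A) = \int[mu]_x \1_A x.
  by rewrite /Rintegral integral_indic// setIT.
have m1 : measurable_fun setT (\1_A : T -> R) by exact: measurable_indic.
apply: le_Rintegral_ae.
- exact/measurable_normc/L2_cmeasurable.
- by apply: integrable_indic.
- by move=> x; exact: normc_ge0.
- by have := indicL2E mu mA; apply: filterS => x ->; rewrite normc_real ger0_norm.
Qed.

Lemma sqnorm_indicL2 A (mA : measurable A) : sqnorm (indicL2 mu mA) <= fine (mu A).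
Proof.
have -> : fine (mu A) = \int[mu]_x \1_A x.
  by rewrite /Rintegral integral_indic// setIT.
apply: le_Rintegral_ae.
- exact/measurable_funX/measurable_normc/L2_cmeasurable.
- by apply: integrable_indic.
- by move=> x; exact: sqr_ge0.
- have := indicL2E mu mA; apply: filterS => x ->; rewrite normc_cindic.
  by rewrite indicE; case: (x \in A); rewrite ?expr0n ?expr1n.
Qed.

Lemma indicL2D A B (mA : measurable A) (mB : measurable B) : B `<=` A ->
  indicL2 mu (measurableD mA mB) = indicL2 mu mA - indicL2 mu mB.
Proof.
move=> BA; apply: L2_ext; have hB := L2reprB (indicL2 mu mA) (indicL2 mu mB).
apply: filterS3 (indicL2E mu mA) (indicL2E mu mB)
  (filterI hB (indicL2E mu (measurableD mA mB))) => x Ax Bx [Dx ABx].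
rewrite ABx Dx Ax Bx -realcB; congr _%:C; rewrite !indicE in_setD.
have [xA|xA] := boolP (x \in A); have [xB|xB] := boolP (x \in B);
  rewrite ?subrr ?subr0//.
by move: xA; rewrite mem_set//; apply: BA; rewrite -inE.
Qed.

(** Along an ultrafilter the integrals of [u] over all measurable sets converge simultaneously. The
    limits are additive in the set and at most [C] times its measure, so they have a density [f];
    convergence on indicators then extends to all test vectors by [indic_dense]. *)
Lemma weak_limit (U : set_system (L2 mu)) {UU : UltraFilter U} C : 0 <= C ->
  U [set u | {ae mu, forall x, normc (u x) <= C}] ->
  exists w, {ae mu, forall x, normc (w x) <= C} /\ forall h, pairing_cvg U w h.
Proof.
move=> C0 UC.
pose I A u := cintegral mu (fun x => cindic A x * u x).
have IE A (mA : measurable A) u : I A u = inner (indicL2 mu mA) u.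
  apply: eq_ae_cintegral.
  - by apply: cmeasurableM; [exact: cmeasurable_cindic|exact: L2_cmeasurable].
  - exact: cmeasurable_inner.
  - by have := indicL2E mu mA; apply: filterS => x ->; rewrite conj_real.
have Ibnd A : measurable A -> forall u, {ae mu, forall x, normc (u x) <= C} ->
    normc (I A u) <= C * fine (mu A).
  move=> mA u uC; rewrite (IE _ mA); apply: le_trans (le_inner_ae_bounded _ uC) _.
  by rewrite ler_wpM2l// L1norm_indicL2.
have ID A B u : measurable A -> measurable B -> A `&` B = set0 ->
    I (A `|` B) u = I A u + I B u.
  move=> mA mB AB; rewrite (IE _ (measurableU _ _ mA mB)) (IE _ mA) (IE _ mB).
  rewrite -innerDl; congr inner; apply: L2_ext.
  have := L2reprD (indicL2 mu mA) (indicL2 mu mB).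
  move=> hD; apply: filterS3 (indicL2E mu mA) (indicL2E mu mB)
    (filterI hD (indicL2E mu (measurableU _ _ mA mB))) => x Ax Bx [Dx Ux].
  rewrite Ux Dx Ax Bx -[RHS](rmorphD (real_complex R)); congr _%:C.
  rewrite !indicE in_setU.
  have [xA|xA] := boolP (x \in A); have [xB|xB] := boolP (x \in B);
    rewrite ?addr0 ?add0r//.
  by have [] : (set0 : set T) x by rewrite -AB; split; rewrite -inE.
(* [p] is [Re] or [Im]: each component gives a real set function, with density bounded by [C]. *)
have density (p : R[i] -> R) : (forall z, `|p z| <= normc z) ->
    (forall z z' : R[i], p (z + z') = p z + p z') ->
    exists g : T -> R, [/\ measurable_fun setT g, {ae mu, forall x, `|g x| <= C} &
      forall A, measurable A -> (fun u => p (I A u)) @ U --> \int[mu]_(x in A) g x].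
  move=> pn pD.
  have pI A : measurable A -> U [set u | `|p (I A u)| <= C * fine (mu A)].
    by move=> mA; apply: filterS UC => u uC; apply: le_trans (pn _) (Ibnd _ mA _ uC).
  (* [L] must be total, and its values on nonmeasurable sets are arbitrary. *)
  have /choice[L LP] : forall A, exists l : R, measurable A -> (fun u => p (I A u)) @ U --> l.
    move=> A; have [mA|nA] := pselect (measurable A); last by exists 0.
    by have [l ll] := ultra_cvg_bounded (pI _ mA); exists l.
  have [||g [mg gC gL]] := @bounded_charge_density _ _ _ mu L C C0.
  - move=> A mA; rewrite ler_norml; apply/andP; split.
      rewrite -lerN2 opprK; apply: (cvg_le_bound (cvgN (LP _ mA))).
      by apply: filterS (pI _ mA) => u /=; rewrite ler_norml => /andP[h _]; rewrite lerNl.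
    apply: (cvg_le_bound (LP _ mA)).
    by apply: filterS (pI _ mA) => u /=; rewrite ler_norml => /andP[].
  - move=> A B mA mB AB.
    have := cvgD (LP _ mA) (LP _ mB).
    have := LP _ (measurableU _ _ mA mB).
    rewrite (_ : (fun u => p (I (A `|` B) u)) = (fun u => p (I A u)) \+ (fun u => p (I B u))).
      move=> h1 h2; have e1 := cvg_lim (@Rhausdorff R) h1.
      have e2 := cvg_lim (@Rhausdorff R) (h2 _).
      exact: etrans (esym (e1 _)) (e2 _ _).
    by apply/funext => u /=; rewrite ID// pD.
  - by exists g; split => // A mA; rewrite -gL//; exact: LP.
have [gr [mgr grC grI]] := density (@complex.Re R)
  (fun z => proj1 (normc_ge_ReIm z)) (@ReD R).
have [gi [mgi giC giI]] := density (@complex.Im R)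
  (fun z => proj2 (normc_ge_ReIm z)) (@ImD R).
pose f x : R[i] := gr x +i* gi x.
have mf : cmeasurable f by [].
(* A provisional bound from the two components, enough to place [f] in L_2. *)
have fC : {ae mu, forall x, normc (f x) <= 2 * C}.
  apply: filterS2 grC giC => x rC iC; apply: le_trans (normc_le_ReIm _) _ => /=.
  by rewrite mulr_natl mulr2n lerD.
have fL : f \in L2pred mu by exact: ae_bounded_L2 fC.
pose w := L2class (MkL2fun fL).
have wE : {ae mu, forall x, w x = f x} by exact: L2reprK.
have C20 : 0 <= 2 * C by rewrite mulr_ge0.
have indw A (mA : measurable A) : pairing_cvg U w (indicL2 mu mA).
  have E (g : T -> R) : \int[mu]_(x in A) g x = \int[mu]_x (\1_A x * g x).
    rewrite Rintegral_mkcond; apply: eq_Rintegral => x _.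
    by rewrite patchE indicE; case: (x \in A); rewrite ?mul1r ?mul0r.
  have wI : inner (indicL2 mu mA) w =
      (\int[mu]_(x in A) gr x) +i* (\int[mu]_(x in A) gi x).
    transitivity (cintegral mu (fun x => cindic A x * f x)).
      apply: eq_ae_cintegral; first exact: cmeasurable_inner.
        by apply: cmeasurableM => //; exact: cmeasurable_cindic.
      have := indicL2E mu mA; apply: filterS2 wE => x -> ->.
      by rewrite conj_real.
    rewrite /cintegral !E; congr (_ +i* _); apply: eq_Rintegral => x _.
      by rewrite ReZ.
    by rewrite ImZ.
  move=> e e0; have e20 : 0 < e / 2 by rewrite divr_gt0.
  have /cvgrPdist_lt/(_ _ e20) := grI _ mA.
  have /cvgrPdist_lt/(_ _ e20) := giI _ mA.
  apply: filterS2 => u; rewrite (IE _ mA) /mkset wI => ui ur.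
  apply: le_lt_trans (normc_le_ReIm _) _; rewrite [ltRHS](splitr e).
  move: ui ur; rewrite distrC => ui; rewrite distrC => ur.
  by case: (inner _ _) ui ur => a b /= ui ur; exact: ltrD.
have UC2 : U [set u | L2norm u <= C].
  by apply: filterS UC => u uC; exact: L2norm_ae_bounded.
have conv h : pairing_cvg U w h.
  apply: indic_dense indw h; first exact: subspace_pairing_cvg.
  exact: L2closed_pairing_cvg UC2.
(* The bound [C] itself is recovered by duality: the pairings of the [u] with [h] are at most
   [C * L1norm h], and this passes to the limit. *)
exists w; split => //; apply: ae_bounded_inner => // h.
apply/ler_addgt0Pr => e e0.
have [u [/= uC hu]] := filter_ex (filterI UC (conv h e e0)).
have := le_normcD (inner h u) (inner h w - inner h u).
rewrite addrC subrK => hle; apply: le_trans hle _; apply: lerD; first exact: le_inner_ae_bounded.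
by rewrite normcB ltW.
Qed.

End WeakLimit.

(** * Density of rectangles in L_2(V x V) *)

Section ProductDensity.
Context {d : measure_display} {V : measurableType d} {R : realType}.
Variable P : probability V R.
Let PP : probability (V * V)%type R := (P \x P)%E.

Lemma tensor_indic A B (mA : measurable A) (mB : measurable B) :
  tensor (indicL2 P mA) (indicL2 P mB) = indicL2 PP (measurableX mA mB).
Proof.
apply: L2_ext; apply: filterS3 (tensorE (indicL2 P mA) (indicL2 P mB))
  (filterI (ae_fst (indicL2E P mA)) (ae_snd (indicL2E P mB)))
  (indicL2E PP (measurableX mA mB)) => z -> [-> ->] ->.
rewrite conj_real -realcM; congr _%:C.
by rewrite !indicE in_setX; case: (_ \in A); case: (_ \in B); rewrite /= ?mulr0 ?mulr1.
Qed.

(** The sets whose indicator lies in [S] form a lambda-system: linearity gives proper differences,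
    closedness gives increasing unions. It contains the rectangles, which are stable under
    intersection and generate the product sigma-algebra, so [indic_dense] applies. *)
Lemma tensor_dense (S : set (L2kernel P)) : subspace S -> L2closed S ->
  (forall A B (mA : measurable A) (mB : measurable B),
    S (tensor (indicL2 P mA) (indicL2 P mB))) -> forall M, S M.
Proof.
move=> sS cS tS M.
(* [indicL2] depends on a proof of measurability, hence the existential; [Prop_irrelevance]
   identifies two such proofs. *)
pose H := [set E : set (V * V) | exists mE : measurable E, S (indicL2 PP mE)].
suff HE E (mE : measurable E) : H E.
  apply: (indic_dense (mu := PP)) => // E mE.
  by have [mE' ?] := HE _ mE; rewrite (Prop_irrelevance mE mE').
pose C : set (set (V * V)) :=
  [set A `*` B | A in measurable & B in measurable].
have CI : setI_closed C.
  move=> _ _ [X1 mX1 [X2 mX2 <-]] [Y1 mY1 [Y2 mY2 <-]].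
  rewrite -setXI; exists (X1 `&` Y1); first exact: measurableI.
  by exists (X2 `&` Y2) => //; exact: measurableI.
have HX A B : measurable A -> measurable B -> H (A `*` B).
  by move=> mA mB; exists (measurableX mA mB); rewrite -tensor_indic.
have mE' : <<s setT, C >> E by rewrite -measurable_prod_measurableType.
apply: (lambda_system_subset CI _ _ _ mE') => //; last first.
  by move=> _ [A mA [B mB <-]]; exact: HX.
split => //.
- by rewrite -setXTT; exact: HX.
- move=> A B BA [mA SA] [mB SB]; exists (measurableD mA mB).
  by rewrite indicL2D//; exact: subspaceB.
- move=> F ndF HF; have mF n : measurable (F n) by have [] := HF n.
  have mU : measurable (\bigcup_i F i) by exact: bigcup_measurable.
  exists mU; apply: cS => e e0.
  have FU n : F n `<=` \bigcup_i F i by move=> x Fx; exists n.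
  have : (fun n => PP (F n)) @ \oo --> PP (\bigcup_i F i).
    exact: (nondecreasing_cvg_mu (mu := PP) mF mU ndF).
  rewrite -(fineK (fin_num_measure PP _ mU)) => /fine_cvgP[_].
  move=> /cvgrPdist_lt /(_ (e ^+ 2)); rewrite exprn_gt0// => /(_ isT)[n _].
  move=> /(_ n (leqnn n)) /= ne; exists (indicL2 PP (mF n)).
    by have [mFn ?] := HF n; rewrite (Prop_irrelevance (mF n) mFn).
  rewrite -(@ltr_pXn2r _ 2)// ?nnegrE ?L2norm_ge0 ?ltW// sqr_L2norm -indicL2D//.
  apply: le_lt_trans (sqnorm_indicL2 _ _) _.
  rewrite measureD//; last by rewrite ltey_eq fin_num_measure.
  apply: le_lt_trans ne; rewrite (setIidr (FU n)).
  by rewrite fineB ?fin_num_measure// ler_norm.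
Qed.

End ProductDensity.

(** * Spectral theory of invariant kernels *)

Lemma ultrafilter_fmap (X Y : Type) (f : X -> Y) (U : set_system X) :
  UltraFilter U -> UltraFilter (f @ U).
Proof.
move=> UU; split; first exact: fmap_proper_filter.
move=> F FF UF; apply/seteqP; split; last exact: UF.
move=> A FA; have [//|nA] := in_ultra_setVsetC (f @^-1` A) UU.
by have [y []] := filter_ex (filterI FA (UF (~` A) nA)).
Qed.

Section CompleteContinuity.
Context {d : measure_display} {V : measurableType d} {R : realType}.
Variable P : probability V R.
Implicit Types (M N : L2kernel P) (u v w h : L2 P).

Lemma kact0l u : kact (0 : L2kernel P) u = 0.
Proof.
apply: (addrI (kact (0 : L2kernel P) u)).
by rewrite -{1}[kact _ _]scale1r -kactZDl scaler0 !addr0.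
Qed.

(** Complete continuity of Hilbert-Schmidt operators. As a property of [M] it is linear, it is
    closed thanks to the bound [B], and for [tensor a b] it is weak convergence against [b], since
    the image of [u] is [inner b u *: a]. *)
Lemma kact_cvg (U : set_system (L2 P)) {FU : Filter U} w (B : R) : 0 <= B ->
  U [set u | L2norm u <= B] -> (forall h, pairing_cvg U w h) ->
  forall M e, 0 < e -> U [set u | L2norm (kact M u - kact M w) < e].
Proof.
move=> B0 UB Uw.
apply: (@tensor_dense _ _ _ _ [set M | forall e : R, 0 < e ->
  U [set u | L2norm (kact M u - kact M w) < e]]).
- split=> [e e0|a M N hM hN e e0].
    by apply: nearW => u; rewrite /mkset !kact0l subrr L2norm0.
  have a1 : 0 < normc a + 1 by rewrite ltr_wpDl ?normc_ge0.
  have e20 : 0 < e / 2 by rewrite divr_gt0.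
  have := hN _ e20; have := hM _ (divr_gt0 e20 a1).
  apply: filterS2 => u; rewrite /mkset ltr_pdivlMr// => h1 h2.
  rewrite !kactZDl opprD addrACA -scalerBr [ltRHS](splitr e).
  apply: le_lt_trans (L2normD _ _) _; rewrite ler_ltD// L2normZ.
  apply: le_trans (ltW h1); rewrite mulrC ler_wpM2l ?L2norm_ge0//.
  by rewrite lerDl.
- move=> M hM e e0.
  pose D := B + L2norm w + 1.
  have D0 : 0 < D by rewrite ltr_wpDl ?addr_ge0 ?L2norm_ge0.
  have e20 : 0 < e / 2 by rewrite divr_gt0.
  have [N hN MN] := hM _ (divr_gt0 e20 D0).
  apply: filterS2 (hN _ e20) UB => u; rewrite /mkset => h1 uB.
  have -> : kact M u - kact M w = (kact N u - kact N w) + kact (M - N) (u - w).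
    by rewrite kactBl !kactB [RHS]addrC subrK.
  apply: le_lt_trans (L2normD _ _) _; rewrite [ltRHS](splitr e) ltr_leD//.
  apply: le_trans (L2norm_kact _ _) _.
  rewrite ltr_pdivlMr// in MN; apply: le_trans (ltW MN).
  rewrite ler_wpM2l ?L2norm_ge0//; apply: le_trans (L2normB _ _) _.
  by rewrite /D ler_wpDr// lerD2r.
- move=> A1 B1 mA mB e e0; set a := indicL2 _ _; set b := indicL2 _ _.
  have a1 : 0 < L2norm a + 1 by rewrite ltr_wpDl ?L2norm_ge0.
  apply: filterS (Uw b _ (divr_gt0 e0 a1)) => u; rewrite /mkset => h1.
  rewrite !kact_tensor -scalerBl L2normZ.
  rewrite ltr_pdivlMr// in h1; apply: le_lt_trans h1.
  by rewrite ler_wpM2l ?normc_ge0// lerDl.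
Qed.

Lemma L1norm_tensor u v :
  L1norm (mu := (P \x P)%E) (tensor u v) <= L1norm u * L1norm v.
Proof.
have iT : (P \x P)%E.-integrable setT
    (EFin \o (fun z => normc (u z.1) * normc (v z.2))).
  have iN := integrable_L2 (mu := (P \x P)%E) (tensor u v).
  have mf : measurable_fun setT (fun z : V * V => normc (u z.1) * normc (v z.2)).
    apply: measurable_funM.
      exact: (measurableT_comp (measurable_normc (L2_cmeasurable u)) measurable_fst).
    exact: (measurableT_comp (measurable_normc (L2_cmeasurable v)) measurable_snd).
  apply/integrableP; split; first exact/measurable_EFinP.
  have /integrableP[mN] := iN; apply: le_lt_trans.
  apply: ae_ge0_le_integral => //.
  - by apply: measurableT_comp => //; exact/measurable_EFinP.
  - exact: measurableT_comp.
  - have := tensorE u v; apply: filterS => z tz _ /=.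
    have -> : normc (u z.1) * normc (v z.2) = normc (L2repr (tensor u v) z).
      by rewrite tz normcM normc_conj.
    exact: lexx.
have -> : L1norm u * L1norm v = \int[(P \x P)%E]_z (normc (u z.1) * normc (v z.2)).
  apply/esym; rewrite mulrC -RintegralZl//; last exact: integrable_L2.
  apply: Rintegral_fubini => //.
    by apply: measurable_funM => //; exact/measurable_normc/L2_cmeasurable.
  apply: nearW => x; rewrite mulrC -RintegralZl//; exact: integrable_L2.
apply: (le_Rintegral_ae (mu := (P \x P)%E)) => //.
- exact/measurable_normc/L2_cmeasurable.
- by move=> x; exact: normc_ge0.
- have := tensorE u v; apply: filterS => z tz.
  have -> : normc (u z.1) * normc (v z.2) = normc (L2repr (tensor u v) z).
    by rewrite tz normcM normc_conj.
  exact: lexx.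
Qed.

(** The pairing of [h] with [kact M u] is that of [M] with [tensor h u], at most [C] times the
    product of the L_1 norms. This makes [weak_limit] available for the images of unit vectors. *)
Lemma ae_bounded_kact M (C : R) u : 0 <= C ->
  {ae (P \x P)%E, forall z, normc (L2repr M z) <= C} -> L2norm u <= 1 ->
  {ae P, forall x, normc (kact M u x) <= 2 * C}.
Proof.
move=> C0 MC u1; apply: ae_bounded_inner; first by rewrite mulr_ge0.
move=> h; rewrite -inner_tensor.
apply: le_trans (le_inner_ae_bounded (mu := (P \x P)%E) (tensor h u) MC) _.
apply: le_trans (ler_wpM2l C0 (L1norm_tensor _ _)) _.
have := L1norm_le u1; have := mulr_ge0 C0 (L1norm_ge0 h); nra.
Qed.

End CompleteContinuity.

(** * Eigenvectors of the square of a self-adjoint kernel *)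

Section Eigenvectors.
Context {d : measure_display} {V : measurableType d} {R : realType}.
Variable P : probability V R.
Implicit Types (u v w h : L2 P).
Variable M : L2kernel P.
Hypothesis sM : self_adjoint M.
Local Notation K := (kact M).

Section RestrictedNorm.
Variables (X : set (L2 P)) (s : R).
Hypotheses (XK : forall v, X v -> X (K v)) (Ks : forall v, X v -> L2norm (K v) <= s * L2norm v).

(* [s] being the norm of [K] on [X], a vector almost attaining it is almost an
   eigenvector of [K^2] for the eigenvalue [s ^+ 2]. *)
Lemma sqnorm_almost_eigenvector u : 0 <= s -> X u -> L2norm u <= 1 ->
  sqnorm (K (K u) - (s ^+ 2)%:C *: u) <= s ^+ 2 * (s ^+ 2 - sqnorm (K u)).
Proof.
move=> s0 Xu u1; rewrite sqnormB innerZr -(self_adjoint_kact _ _ sM) ReZ.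
rewrite inner_sqnorm sqnormZ normc_real /=.
have h1 : sqnorm (K (K u)) <= s ^+ 2 * sqnorm (K u).
  rewrite -!sqr_L2norm -exprMn ler_sqr ?nnegrE ?mulr_ge0 ?L2norm_ge0//.
  exact/Ks/XK.
have h2 : sqnorm u <= 1 by rewrite -sqr_L2norm expr_le1// L2norm_ge0.
rewrite real_normK ?num_real//.
have : 0 <= s ^+ 2 by rewrite sqr_ge0.
move: h1 h2; have := sqnorm_ge0 u; move: (s ^+ 2) => t.
move=> a b c e; have : t ^+ 2 * sqnorm u <= t ^+ 2 by rewrite ler_piMr ?sqr_ge0.
lra.
Qed.

End RestrictedNorm.

(** Let [s] be the norm of [K] on [X], and follow an ultrafilter of almost maximizing vectors [u].
    The bounded functions [K u] have a weak limit [w], so [K (K u)] tends to [K w] in norm; as it is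
    also close to [s^2 u], the [u] converge in norm to an eigenvector, which lies in [X] because [X]
    is closed. *)
Lemma exists_eigenvector (X : set (L2 P)) (C eps : R) v0 :
  0 <= C -> {ae (P \x P)%E, forall z, normc (L2repr M z) <= C} ->
  subspace X -> L2closed X -> (forall v, X v -> X (K v)) ->
  0 < eps -> X v0 -> eps * L2norm v0 < L2norm (K v0) ->
  exists s v, [/\ eps < s, X v, v != 0 & K (K v) = (s ^+ 2)%:C *: v].
Proof.
move=> C0 MC sX cX XK eps0 Xv0 hv0.
pose A := [set r | exists u, [/\ X u, L2norm u <= 1 & r = L2norm (K u)]].
have A0 : A 0.
  by exists 0; split; rewrite ?kact0 ?L2norm0//; have [] := sX.
have supA : has_sup A.
  split; first by exists 0.
  exists (L2norm M) => _ [u [_ u1 ->]]; apply: le_trans (L2norm_kact _ _) _.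
  by rewrite ler_piMr ?L2norm_ge0.
pose s := sup A.
have Ks v : X v -> L2norm (K v) <= s * L2norm v.
  move=> Xv; have [->|v_neq0] := eqVneq v 0; first by rewrite kact0 !L2norm0 mulr0.
  have nv : 0 < L2norm v.
    by rewrite lt_def L2norm_ge0 andbT; apply: contra_neq v_neq0; exact: L2norm_eq0.
  rewrite -ler_pdivrMr//; apply: sup_upper_bound => //.
  exists (((L2norm v)^-1)%:C *: v); split; first exact: subspaceZ.
    by rewrite L2normZ normc_real ger0_norm ?invr_ge0 ?L2norm_ge0// mulVf ?gt_eqF.
  by rewrite kactZ L2normZ normc_real ger0_norm ?invr_ge0 ?L2norm_ge0// mulrC.
have eps_s : eps < s.
  rewrite ltNge; apply/negP => s_eps; move: hv0; rewrite ltNge; apply/negP.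
  by rewrite negbK; apply: le_trans (Ks _ Xv0) _; rewrite ler_wpM2r ?L2norm_ge0.
have s0 : 0 < s by exact: lt_trans eps_s.
(* These sets are nested and, [s] being a supremum, never empty: they generate a proper filter. *)
pose N (r : R) := [set u | [/\ X u, L2norm u <= 1 & s - r < L2norm (K u)]].
pose F := filter_from [set r : R | 0 < r] N.
have FF : ProperFilter F.
  apply: filter_from_proper.
    apply: filter_from_filter; first by exists 1 => /=.
    move=> r t r0 t0; exists (Num.min r t); first by rewrite /= lt_min r0.
    move=> u [Xu u1]; rewrite ltrBlDr -ltrBlDl lt_min => /andP[hr ht].
    by split; split => //; rewrite ltrBlDr -ltrBlDl.
  move=> r r0; have [_ [u [Xu u1 ->]] su] := sup_adherent r0 supA.
  by exists u.
have [U [UU FU]] := ultraFilterLemma FF.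
have UN r : 0 < r -> U (N r) by move=> r0; apply: FU; exists r.
have UK := ultrafilter_fmap K UU.
have C20 : 0 <= 2 * C by rewrite mulr_ge0.
have bK : U (K @^-1` [set y : L2 P | {ae P, forall x, normc (y x) <= 2 * C}]).
  by apply: filterS (UN 1 ltr01) => u [_ u1 _]; exact: ae_bounded_kact.
have [w [_ wU]] := weak_limit (U := K @ U) C20 bK.
have bK2 : U (K @^-1` [set y : L2 P | L2norm y <= 2 * C]).
  by apply: filterS bK => y yC; exact: L2norm_ae_bounded.
have K2U e : 0 < e -> U [set u | L2norm (K (K u) - K w) < e].
  exact: (kact_cvg (U := K @ U) C20 bK2 wU).
have s20 : 0 < s ^+ 2 by rewrite exprn_gt0.
pose v := ((s ^+ 2)^-1)%:C *: K w.
have vK : K w = (s ^+ 2)%:C *: v.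
  by rewrite scalerA -realcM mulfV ?gt_eqF// scale1r.
have approx e : 0 < e -> exists u, [/\ X u, L2norm (u - v) < e,
    L2norm (K (K u) - (s ^+ 2)%:C *: u) < e & s - e < L2norm (K u)].
  (* [eta] is the tolerance for both terms of [s^2 (u - v) = (K (K u) - K w) - (K (K u) - s^2 u)],
     whence [2 eta <= e s^2]. *)
  move=> e0; pose eta := Num.min e (e * s ^+ 2 / 2).
  have eta0 : 0 < eta by rewrite lt_min e0 divr_gt0// mulr_gt0.
  (* The bound of [sqnorm_almost_eigenvector] becomes [s^2 (s^2 - (s - r)^2)], which this [r] makes
     less than [eta^2]; the summand 1 gives strictness, and [r <= s] allows [s - r] to be
     squared. *)
  pose r := Num.min e (Num.min s (eta ^+ 2 / (2 * s ^+ 3 + 1))).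
  have D0 : 0 < 2 * s ^+ 3 + 1 by rewrite ltr_wpDl// mulr_ge0// exprn_ge0// ltW.
  have r0 : 0 < r by rewrite !lt_min e0 s0 divr_gt0// exprn_gt0.
  have [u [[Xu u1 su] uw]] := filter_ex (filterI (UN _ r0) (K2U eta eta0)).
  have {}uw : L2norm (K (K u) - K w) < eta by [].
  have hu : L2norm (K (K u) - (s ^+ 2)%:C *: u) < eta.
    rewrite -(@ltr_pXn2r _ 2)// ?nnegrE ?L2norm_ge0 ?ltW// sqr_L2norm.
    apply: le_lt_trans (sqnorm_almost_eigenvector XK Ks (ltW s0) Xu u1) _.
    have re : r <= s by rewrite /r !ge_min lexx !orbT.
    have rs : 0 <= s - r by rewrite subr_ge0.
    have : r * (2 * s ^+ 3 + 1) <= eta ^+ 2.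
      by rewrite -ler_pdivlMr// /r !ge_min lexx !orbT.
    apply: lt_le_trans; rewrite -sqr_L2norm.
    have k2 : (s - r) ^+ 2 <= L2norm (K u) ^+ 2.
      by rewrite ler_sqr ?nnegrE ?L2norm_ge0// ltW.
    apply: (@le_lt_trans _ _ (s ^+ 2 * (2 * s * r - r ^+ 2))).
      rewrite ler_wpM2l ?(ltW s20)//; move: k2; rewrite sqrrB.
      have -> : s * r *+ 2 = 2 * s * r by ring.
      lra.
    have : 0 <= s ^+ 2 * r ^+ 2 by rewrite mulr_ge0// sqr_ge0.
    have -> : s ^+ 2 * (2 * s * r - r ^+ 2) = 2 * s ^+ 3 * r - s ^+ 2 * r ^+ 2 by ring.
    have -> : r * (2 * s ^+ 3 + 1) = 2 * s ^+ 3 * r + r by ring.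
    by lra.
  exists u; split => //.
  - have : (s ^+ 2)%:C *: (u - v) = (K (K u) - K w) - (K (K u) - (s ^+ 2)%:C *: u).
      by rewrite vK scalerBr opprB [RHS]addrC addrA subrK.
    move=> /(congr1 (@L2norm _ _ _ _)); rewrite L2normZ normc_real gtr0_norm// => E.
    rewrite -(ltr_pM2l s20) E; apply: le_lt_trans (L2normB _ _) _.
    apply: lt_le_trans (ltrD uw hu) _.
    have : eta <= e * s ^+ 2 / 2 by rewrite /eta ge_min lexx orbT.
    lra.
  - by apply: lt_le_trans hu _; rewrite /eta ge_min lexx.
  - by apply: le_lt_trans su; rewrite lerD2l lerN2 /r ge_min lexx.
exists s, v; split => //.
- apply: cX => e /approx[u [Xu uv _ _]]; exists u => //.
  by rewrite -L2normN opprB.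
(* Were [v] zero, [u] would have norm less than [q = s / (L2norm M + 2)]. Then [s - q], being below
   the norm of [K u], would be at most [L2norm M * q], against [s = (L2norm M + 2) q]. *)
- apply/eqP => v0'; have M0 : 0 < L2norm M + 2 by rewrite ltr_wpDl ?L2norm_ge0.
  have [u [_ + _ su]] := approx _ (divr_gt0 s0 M0).
  rewrite v0' subr0 => hu; have := le_trans (ltW su) (L2norm_kact M u).
  rewrite ltr_pdivlMr// in hu.
  have : s / (L2norm M + 2) * (L2norm M + 2) = s by rewrite divfK// gt_eqF.
  set q := s / _; have := L2norm_ge0 M; have := L2norm_ge0 u.
  nra.
- apply/eqP; rewrite -subr_eq0; apply/eqP/L2norm_eq0/eqP.
  rewrite eq_le L2norm_ge0 andbT; apply/ler_addgt0Pr => e e0; rewrite add0r.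
  (* [D] adds up the coefficients of the three errors that arise when [v] is replaced by [u]. *)
  pose D := L2norm M * L2norm M + s ^+ 2 + 1.
  have D0 : 0 < D.
    by rewrite ltr_wpDl// addr_ge0 ?(ltW s20)// mulr_ge0// L2norm_ge0.
  have [u [_ uv uK _]] := approx _ (divr_gt0 e0 D0).
  have -> : K (K v) - (s ^+ 2)%:C *: v = K (K (v - u)) +
      (K (K u) - (s ^+ 2)%:C *: u) + (s ^+ 2)%:C *: (u - v).
    by rewrite !kactB scalerBr [X in X + (_ - _ *: v)]addrA subrK addrA subrK.
  have vu : L2norm (v - u) < e / D by rewrite -L2normN opprB.
  have h1 : L2norm (K (K (v - u))) <= L2norm M * L2norm M * (e / D).
    apply: le_trans (L2norm_kact _ _) _; rewrite -mulrA ler_wpM2l ?L2norm_ge0//.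
    apply: le_trans (L2norm_kact _ _) _; rewrite ler_wpM2l ?L2norm_ge0//.
    exact: ltW.
  have h2 : L2norm ((s ^+ 2)%:C *: (u - v)) <= s ^+ 2 * (e / D).
    rewrite L2normZ normc_real gtr0_norm// ler_wpM2l ?(ltW s20)//.
    exact: ltW.
  have eD : e = L2norm M * L2norm M * (e / D) + e / D + s ^+ 2 * (e / D).
    rewrite {1}(_ : e = D * (e / D)); last by rewrite mulrCA divff ?mulr1 ?gt_eqF.
    by rewrite /D; ring.
  rewrite eD; apply: le_trans (L2normD _ _) _; apply: lerD h2.
  apply: le_trans (L2normD _ _) _; apply: lerD h1 _; exact: ltW.
Qed.

(** The vectors [K (e i)] are orthogonal of norm [s], since [K] is self-adjoint and its square acts
    as [s^2]. Hence the tensors [t i] are orthonormal in L_2(V x V), each has pairing [s] with [M],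
    and Bessel's inequality concludes. *)
Lemma eigenspace_orthonormal_leq (s : R) k (e : 'I_k -> L2 P) : 0 < s ->
  orthonormal e -> (forall i, K (K (e i)) = (s ^+ 2)%:C *: e i) ->
  k%:R * s ^+ 2 <= sqnorm M.
Proof.
move=> s0 eON eE; pose t i : L2kernel P := tensor ((s^-1)%:C *: K (e i)) (e i).
have KK i j : inner (K (e i)) (K (e j)) = (s ^+ 2)%:C * (i == j)%:R.
  by rewrite -self_adjoint_kact// eE innerZr eON.
have tON : orthonormal t.
  move=> i j; rewrite inner_tensor2 innerZl innerZr KK eON conj_real.
  have [_|ij] := eqVneq i j; last by rewrite !mulr0 mul0r.
  rewrite conjC1 !mulr1 -!realcM; congr _%:C.
  by field; rewrite gt_eqF.
have := Bessel tON M.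
under eq_bigr => i _.
  rewrite inner_tensor innerZl KK eqxx mulr1 conj_real -realcM normc_real.
  rewrite expr2 mulrA mulVf ?gt_eqF// mul1r gtr0_norm//.
  over.
by rewrite sumr_const card_ord mulr_natl.
Qed.

End Eigenvectors.

(** * Invariant kernels on and off the low dimensional invariant subspaces *)

Section InvariantKernels.
Context {d : measure_display} {V : measurableType d} {R : realType}.
Variable P : probability V R.
Variable G : set (L2 P -> L2 P).
Hypotheses (uG : unitary_group G) (wG : acts_weakly_random G).
Implicit Types (u v w h : L2 P) (M : L2kernel P).

(* Finite dimensional by weak randomness; off it the invariant kernels have small
   operator norm. *)
Definition low_dim_span n : set (L2 P) :=
  span (\bigcup_(S in [set S | dim_le n S /\ invariant_subspace G S]) S).

Lemma kernel_invariant_comm M a u : kernel_invariant G M -> G a ->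
  a (kact M u) = kact M (a u).
Proof.
move=> iM Ga; have [_ _ _ inv] := uG; have [b [_ ab ba]] := inv _ Ga.
by have := congr1 (fun f => f (a u)) (iM a b Ga ab ba); rewrite /= ab.
Qed.

(** The image under [M] of an invariant subspace of dimension at most [n] is again one: its
    dimension does not grow, and it is invariant because [M] commutes with [G]. *)
Lemma kact_low_dim_span M n v : kernel_invariant G M ->
  low_dim_span n v -> low_dim_span n (kact M v).
Proof.
move=> iM; move: v; apply: span_subset => [|v [S [[x Sx] Sinv] Sv]].
  have [W0 WZ] := subspace_span
    (\bigcup_(S in [set S : set (L2 P) | dim_le n S /\ invariant_subspace G S]) S).
  split=> [|a u v hu hv] /=; first by rewrite kact0.
  by rewrite kactZDr; exact: WZ.
apply: subset_span; exists (kact M @` S); last by exists v.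
split.
  exists (kact M \o x); apply/seteqP; split.
    move=> _ [u + <-]; rewrite Sx => -[m [a [y [yx ->]]]].
    exists m, a, (kact M \o y); split; last by rewrite kact_sum.
    by move=> i; have [j _ xj] := yx i; exists j => //=; rewrite xj.
  apply: span_subset => [|_ [j _ <-]].
    split=> [|a _ _ [u Su <-] [u' Su' <-]].
      by exists 0; rewrite ?kact0// Sx; have [] := subspace_span (range x).
    exists (a *: u + u'); last by rewrite kactZDr.
    by move: Su Su'; rewrite Sx; have [_] := subspace_span (range x); exact.
  by exists (x j) => //; rewrite Sx; apply: subset_span; exists j.
move=> a Ga _ [_ [u Su <-] <-]; rewrite kernel_invariant_comm//.
by exists (a u) => //; apply: (Sinv a Ga); exists u.
Qed.

(** By contradiction: a larger norm would give an eigenvector orthogonal to the span, while its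
    eigenspace is one of the subspaces that generate the span. It would be orthogonal to itself. *)
Lemma kact_orthogonal_small M n (C eps : R) v : 0 <= C -> 0 < eps ->
  C ^+ 2 <= n%:R * eps ^+ 2 ->
  self_adjoint M -> kernel_invariant G M ->
  {ae (P \x P)%E, forall z, normc (L2repr M z) <= C} ->
  (forall w, low_dim_span n w -> inner w v = 0) ->
  L2norm (kact M v) <= eps * L2norm v.
Proof.
move=> C0 eps0 nC sM iM MC vW; rewrite leNgt; apply/negP => hv.
pose X := [set u | forall w, low_dim_span n w -> inner w u = 0].
have sX : subspace X.
  split=> [w _|a u u' Xu Xu' w Ww]; first by rewrite inner0r.
  by rewrite innerDr innerZr Xu// Xu'// mulr0 addr0.
have cX : L2closed X.
  move=> u hu w Ww; apply: eq0_normc; apply/eqP.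
  rewrite eq_le normc_ge0 andbT; apply/ler_addgt0Pr => e e0; rewrite add0r.
  have w1 : 0 < L2norm w + 1 by rewrite ltr_wpDl ?L2norm_ge0.
  have [u' Xu' uu'] := hu _ (divr_gt0 e0 w1).
  rewrite -[u](subrK u') innerDr Xu'// addr0.
  apply: le_trans (CauchySchwarz _ _) _.
  rewrite ltr_pdivlMr// in uu'; apply: le_trans (ltW uu').
  by rewrite mulrC ler_wpM2l ?L2norm_ge0// lerDl.
(* The orthogonal complement of a stable subspace is stable under a self-adjoint operator. *)
have XK u : X u -> X (kact M u).
  by move=> Xu w Ww; rewrite self_adjoint_kact// Xu//; exact: kact_low_dim_span.
have [s [u [eps_s Xu u0 uE]]] := exists_eigenvector sM C0 MC sX cX XK eps0 vW hv.
have s0 : 0 < s by exact: lt_trans eps_s.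
pose E := [set u | kact M (kact M u) = (s ^+ 2)%:C *: u].
have sE : subspace E.
  split=> [|a x y]; first by rewrite /E /= !kact0 scaler0.
  rewrite /E /= => xE yE; rewrite !kactZDr xE yE scalerDr !scalerA.
  by congr (_ *: _ + _); rewrite mulrC.
(* The chain is [k s^2 <= sqnorm M <= C^2 <= n eps^2 <= n s^2]. *)
have dE : dim_le n E.
  apply: orthonormal_dim_le => // k e eON eE.
  have := eigenspace_orthonormal_leq sM s0 eON eE.
  have MC2 : sqnorm M <= C ^+ 2.
    rewrite -sqr_L2norm ler_sqr ?nnegrE ?L2norm_ge0//.
    exact: (L2norm_ae_bounded (mu := (P \x P)%E) C0 MC).
  rewrite -(@ler_nat R) => kM.
  have s20 : 0 < s ^+ 2 by rewrite exprn_gt0.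
  rewrite -(ler_pM2r s20); apply: le_trans kM _; apply: le_trans MC2 _.
  apply: le_trans nC _; rewrite ler_wpM2l ?ler0n// ler_sqr ?nnegrE ?ltW//.
have iE : invariant_subspace G E.
  move=> a Ga _ [x xE <-]; have [Gu _ _ _] := uG; have [la _ _] := Gu _ Ga.
  have a0 : a 0 = 0.
    by have := la (-1) 0 0; rewrite scaler0 addr0 scaleN1r addNr.
  rewrite /E /= -(kernel_invariant_comm x iM Ga) -(kernel_invariant_comm _ iM Ga) xE.
  by rewrite -[_ *: x]addr0 la a0 addr0.
have : low_dim_span n u by apply: subset_span; exists E.
move=> /Xu; rewrite inner_sqnorm => -[/sqnorm_eq0 u00].
by rewrite u00 eqxx in u0.
Qed.

End InvariantKernels.

(** * The cut norm *)

Section Topology.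
Context {d : measure_display} {T : measurableType d} {R : realType}.
Variable mu : {measure set T -> \bar R}.

Lemma normC_real (z : R[i]) : `|z| = (normc z)%:C.
Proof. by rewrite normc_def; case: z. Qed.

Lemma weak_cvgP (F : set_system (L2 mu)) {FF : Filter F} w :
  weak_cvg F w <-> forall h, pairing_cvg F w h.
Proof.
split=> [Fw h e e0|Fw h].
  have /cvgrPdist_lt/(_ e%:C) := Fw h.
  rewrite ltcR => /(_ e0); apply: filterS => u.
  by rewrite /mkset normC_real ltcR normcB.
apply/cvgrPdist_lt => e e0.
(* A positive element of [R[i]] is real, so tolerances in [R[i]] and in [R] correspond. *)
have eE : e = (Re e)%:C by rewrite [LHS]complexE (ger0_Im (ltW e0)) mulr0 addr0.
have e0' : 0 < Re e by move: e0; rewrite {1}eE ltcR.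
apply: filterS (Fw h _ e0') => u; rewrite /mkset normcB => hu.
by rewrite eE normC_real ltcR.
Qed.

Lemma normc_small_eq0 (z : R[i]) : (forall e, 0 < e -> normc z <= e) -> z = 0.
Proof.
move=> hz; apply: eq0_normc; apply/eqP; rewrite eq_le normc_ge0 andbT.
by apply/ler_addgt0Pr => e e0; rewrite add0r; exact: hz.
Qed.

End Topology.

Section CutNorm.
Context {d : measure_display} {V : measurableType d} {R : realType}.
Variable P : probability V R.
Implicit Types (M N : L2kernel P) (c : R).

Lemma cut_cvgP (F : set_system (cut_space P)) {FF : Filter F} (M : cut_space P) :
  F --> M <-> forall e : R, 0 < e -> F [set N | (cut_norm (N - M)%R < e%:E)%E].
Proof.
split=> [FM e e0|h A]; first by apply: FM; rewrite cut_nbhsE; exists e.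
by rewrite cut_nbhsE => -[e e0 eA]; apply: filterS eA _; exact: h.
Qed.

Lemma Linf_ball_cindic (A : set V) : measurable A -> Linf_ball P (cindic A).
Proof.
move=> mA; split; first exact: cmeasurable_cindic.
apply/cLnorm_leP; apply: nearW => x; rewrite normc_cindic indicE.
by case: (x \in A).
Qed.

Lemma Linf_L2_cindic (A : set V) (mA : measurable A) :
  Linf_L2 (Linf_ball_cindic mA) = indicL2 P mA.
Proof. by apply/L2classP; exact: nearW. Qed.

Lemma L2norm_Linf_L2 f (bf : Linf_ball P f) : L2norm (Linf_L2 bf) <= 1.
Proof.
apply: L2norm_ae_bounded => //; have fE : {ae P, forall x, Linf_L2 bf x = f x}.
  exact: L2reprK.
by apply: filterS2 fE (Linf_ball_ae bf) => x ->.
Qed.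

Lemma cut_cvg_pairing_cvg (F : set_system (L2kernel P)) {FF : Filter F} M C :
  0 <= C -> F [set N | L2norm N <= C] ->
  (forall e : R, 0 < e -> F [set N | (cut_norm (N - M)%R < e%:E)%E]) ->
  forall h, pairing_cvg F M h.
Proof.
move=> C0 FC FM; apply: tensor_dense.
- exact: subspace_pairing_cvg.
- exact: (L2closed_pairing_cvg C0 FC).
- move=> A B mA mB e e0; apply: filterS (FM _ e0) => N /= hN.
  rewrite -lte_fin; apply: le_lt_trans hN.
  have := cut_norm_ge (N - M) (Linf_ball_cindic mA) (Linf_ball_cindic mB).
  by rewrite (cut_formE (Linf_ball_cindic mA) (Linf_ball_cindic mB)) !Linf_L2_cindic -inner_tensor innerBr.
Qed.

Lemma invariant_kernels_bounded G c M : invariant_kernels G c M ->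
  {ae (P \x P)%E, forall z, normc (L2repr M z) <= c}.
Proof. by move=> [_ _ /(cLnorm_leP (P \x P)%E)]. Qed.

Lemma L2norm_invariant_kernels G c M : 0 <= c -> invariant_kernels G c M ->
  L2norm M <= c.
Proof.
move=> c0 /invariant_kernels_bounded.
exact: (L2norm_ae_bounded (mu := (P \x P)%E)).
Qed.

Lemma pairing_cvg_cut_cvg (G : set (L2 P -> L2 P)) c
    (F : set_system (L2kernel P)) {FF : Filter F} M :
  unitary_group G -> acts_weakly_random G -> 0 <= c ->
  F (invariant_kernels G c) -> invariant_kernels G c M ->
  (forall h, pairing_cvg F M h) ->
  forall e : R, 0 < e -> F [set N | (cut_norm (N - M)%R < e%:E)%E].
Proof.
move=> uG wG c0 FI IM FM e e0.
(* The budget: each of [N] and [M] contributes at most [eps] off the span, together [e / 2], and the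
   coefficients on the span add at most [k^2 delta <= e / 4]. *)
pose eps := e / 4.
have eps0 : 0 < eps by rewrite divr_gt0.
have [n nC] : exists n : nat, c ^+ 2 <= n%:R * eps ^+ 2.
  exists (Num.bound (c ^+ 2 / eps ^+ 2)).
  rewrite -ler_pdivrMr ?exprn_gt0// ltW// archi_boundP//.
  by rewrite divr_ge0// sqr_ge0.
have [k [b [bON bW bB]]] := finite_dim_orthonormal_basis (wG n).
pose delta := e / 4 / (k%:R ^+ 2 + 1).
have k1 : 0 < k%:R ^+ 2 + 1 :> R by rewrite ltr_wpDl ?sqr_ge0.
have delta0 : 0 < delta by rewrite !divr_gt0.
(* Finitely many conditions, fixed before [f] and [g]: this is where the uniformity in the cut norm
   comes from. *)
have : F [set N | forall i j, normc (inner (b i) (kact (N - M) (b j))) < delta].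
  apply: filter_forall => i; apply: filter_forall => j.
  apply: filterS (FM (tensor (b i) (b j)) _ delta0) => N; rewrite /mkset.
  by rewrite -inner_tensor innerBr.
apply: filterS2 FI => N IN bN.
have small L (IL : invariant_kernels G c L) v :
    (forall w, low_dim_span G n w -> inner w v = 0) ->
    L2norm (kact L v) <= eps * L2norm v.
  have [sL iL _] := IL.
  exact: (kact_orthogonal_small uG c0 eps0 nC sL iL (invariant_kernels_bounded IL)).
suff : (cut_norm (N - M)%R <= (e / 2 + e / 4)%:E)%E.
  by move/le_lt_trans; apply; rewrite lte_fin; lra.
apply: cut_norm_le => f g bf bg; rewrite lee_fin (cut_formE bf bg).
set u := Linf_L2 bf; set v := Linf_L2 bg.
have u1 : L2norm u <= 1 by exact: L2norm_Linf_L2.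
have v1 : L2norm v <= 1 by exact: L2norm_Linf_L2.
pose v' := v - proj b v.
have v'1 : L2norm v' <= 1 by exact: le_trans (L2norm_proj_le bON v) v1.
have v'W w : low_dim_span G n w -> inner w v' = 0.
  move=> /bB ->; rewrite inner_suml big1// => i _.
  by rewrite innerZl inner_proj// mulr0.
(* Both kernels preserve the span, so images of basis vectors expand in [b] again and only the
   coefficients bounded by [bN] occur. *)
have DW j : kact (N - M) (b j) = proj b (kact (N - M) (b j)).
  apply: bB; rewrite kactBl.
  have [[_ iN _] [_ iM _]] := (IN, IM).
  by apply: subspaceB; [exact: subspace_span| |];
    apply: kact_low_dim_span => //; exact: bW.
have coord w i : L2norm w <= 1 -> normc (inner (b i) w) <= 1.
  move=> w1; apply: le_trans (CauchySchwarz _ _) _.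
  have -> : L2norm (b i) = 1.
    by rewrite /L2norm (_ : sqnorm _ = 1) ?sqrtr1//; apply: (@complexI R);
      rewrite -inner_sqnorm bON eqxx.
  by rewrite mul1r.
rewrite -[v](subrK (proj b v)) -/v' kactD innerDr.
apply: le_trans (le_normcD _ _) _; apply: lerD.
  apply: le_trans (CauchySchwarz _ _) _.
  apply: (@le_trans _ _ (L2norm (kact (N - M) v'))).
    by rewrite ler_piMl ?L2norm_ge0.
  rewrite kactBl; apply: le_trans (L2normB _ _) _.
  have := small _ IN _ v'W; have := small _ IM _ v'W.
  have : eps * L2norm v' <= eps by rewrite ler_piMr// ltW.
  rewrite /eps; lra.
rewrite kact_sum inner_sumr.
apply: le_trans (normc_sum _ _ _) _.
apply: (@le_trans _ _ (\sum_(j < k) \sum_(i < k) delta)).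
  apply: ler_sum => j _; rewrite innerZr DW inner_sumr mulr_sumr.
  apply: le_trans (normc_sum _ _ _) _; apply: ler_sum => i _.
  rewrite innerZr !normcM (innerC (b i)) normc_conj.
  have h1 := coord _ j v1; have h2 := coord _ i u1.
  have h3 := ltW (bN i j).
  rewrite mulrC -mulrA -[leRHS]mulr1 ler_pM ?normc_ge0 ?mulr_ge0 ?normc_ge0//.
  by rewrite mulr_ile1 ?normc_ge0.
rewrite !sumr_const !card_ord -mulrnA -[leLHS]mulr_natr natrM -expr2.
rewrite /delta -mulrA ler_piMr//; first by rewrite divr_ge0// ltW.
by rewrite mulrC ler_pdivrMr// mul1r lerDl.
Qed.

Lemma pairing_limit_eq (F : set_system (L2kernel P)) {FF : ProperFilter F} M
    (h k : L2kernel P) :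
  F [set N | inner h N = inner k N] ->
  (forall h, pairing_cvg F M h) -> inner h M = inner k M.
Proof.
move=> hk FM; apply/eqP; rewrite -subr_eq0; apply/eqP/normc_small_eq0 => e e0.
have e20 : 0 < e / 2 by rewrite divr_gt0.
have [N [hkN [hN kN]]] := filter_ex (filterI hk (filterI (FM h _ e20) (FM k _ e20))).
have {}hkN : inner h N = inner k N by [].
rewrite (_ : _ - _ = (inner k N - inner k M) - (inner h N - inner h M)); last first.
  by rewrite hkN; ring.
apply: le_trans (le_normcD _ _) _; rewrite normcN [leRHS](splitr e).
by apply: lerD; exact: ltW.
Qed.

Lemma tensor_ext M N : (forall u v, inner (tensor u v) M = inner (tensor u v) N) ->
  M = N.
Proof.
move=> MN; apply/eqP; rewrite -subr_eq0; apply/eqP.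
suff : forall h : L2kernel P, inner h (M - N) = 0.
  by move=> /(_ (M - N)); rewrite inner_sqnorm => -[/sqnorm_eq0].
apply: (@tensor_dense _ _ _ _ [set h | inner h (M - N) = 0]).
- split=> [|a h k hE kE]; first exact: inner0l.
  by rewrite /= innerDl innerZl hE kE mulr0 addr0.
- move=> h hh; apply: normc_small_eq0 => e e0.
  have w1 : 0 < L2norm (M - N) + 1 by rewrite ltr_wpDl ?L2norm_ge0.
  have [k kE hk] := hh _ (divr_gt0 e0 w1).
  rewrite -[h](subrK k) innerDl kE addr0.
  apply: le_trans (CauchySchwarz _ _) _.
  rewrite ltr_pdivlMr// in hk; apply: le_trans (ltW hk).
  by rewrite ler_wpM2l ?L2norm_ge0// lerDl.
- by move=> A B mA mB; rewrite /= innerBr MN subrr.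
Qed.

Lemma invariant_kernels_closed (G : set (L2 P -> L2 P)) c
    (F : set_system (L2kernel P)) {FF : ProperFilter F} M :
  unitary_group G -> F (invariant_kernels G c) ->
  {ae (P \x P)%E, forall z, normc (L2repr M z) <= c} ->
  (forall h, pairing_cvg F M h) -> invariant_kernels G c M.
Proof.
move=> [uG _ _ _] FI Mc FM; split.
(* Conjugation makes this condition antilinear on one side, so [pairing_limit_eq] does not cover it
   and the limit is taken by hand. *)
- apply/self_adjointP/tensor_ext => u v; rewrite inner_tensor_adjoint.
  apply/eqP; rewrite -subr_eq0; apply/eqP/normc_small_eq0 => e e0.
  have e20 : 0 < e / 2 by rewrite divr_gt0.
  have [N [[sN _ _] [h1 h2]]] := filter_ex (filterI FI
    (filterI (FM (tensor u v) _ e20) (FM (tensor v u) _ e20))).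
  have NE : inner (tensor u v) N = (inner (tensor v u) N)^*.
    by rewrite -inner_tensor_adjoint (self_adjointP N).1.
  have -> : (inner (tensor v u) M)^* - inner (tensor u v) M =
      (inner (tensor u v) N - inner (tensor u v) M) -
      (inner (tensor v u) N - inner (tensor v u) M)^*.
    by rewrite NE rmorphB; ring.
  apply: le_trans (le_normcD _ _) _; rewrite normcN normc_conj [leRHS](splitr e).
  by apply: lerD; exact: ltW.
- move=> a b Ga ab ba; apply/funext => u; apply: innerP => v /=.
  have [_ ia _] := uG _ Ga.
  (* Unitarity removes [a] and leaves equal pairings of [M] with [tensor (b v) (b u)] and
     [tensor v u], a condition that passes to weak limits. *)
  rewrite -[v in LHS]ba ia -!inner_tensor.
  apply: pairing_limit_eq FM; apply: filterS FI => N [_ iN _] /=.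
  rewrite !inner_tensor -ia ba.
  by rewrite -[in RHS](iN a b Ga ab ba).
- exact/(cLnorm_leP (P \x P)%E).
Qed.

End CutNorm.

Theorem theorem4 (R : realType) (d : measure_display) (V : measurableType d)
    (P : probability V R) (G : set (L2 P -> L2 P)) (c : R) :
  separable_measure P ->
  unitary_group G ->
  acts_weakly_random G ->
  0 < c ->
  (forall (F : set_system (L2kernel P)) (M : L2kernel P),
     ProperFilter F ->
     F (invariant_kernels G c) ->
     invariant_kernels G c M ->
     (weak_cvg F M <-> (F : set_system (cut_space P)) --> (M : cut_space P))) /\
  compact (invariant_kernels G c : set (cut_space P)).
Proof.
move=> _ uG wG c0; split=> [F M FF FI IM|].
  rewrite cut_cvgP; split.
    by move=> /weak_cvgP FM; exact: (pairing_cvg_cut_cvg uG wG (ltW c0) FI IM FM).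
  move=> FM; apply/weak_cvgP; apply: (cut_cvg_pairing_cvg (ltW c0)) FM.
  by apply: filterS FI => N; apply: L2norm_invariant_kernels; exact: ltW.
(* The limit is first found weakly from the bound [c] alone; once it is known to lie in the set, the
   convergence is upgraded to the cut norm. *)
have lim (F : set_system (L2kernel P)) : UltraFilter F -> F (invariant_kernels G c) ->
    exists2 M, invariant_kernels G c M &
      forall e : R, 0 < e -> F [set N | (cut_norm (N - M)%R < e%:E)%E].
  move=> UF FI.
  have [M [Mc FM]] := @weak_limit _ _ _ (P \x P)%E F UF c (ltW c0)
    (filterS (@invariant_kernels_bounded _ _ _ P G c) FI).
  have IM : invariant_kernels G c M.
    exact: (invariant_kernels_closed uG FI Mc FM).
  by exists M => //; exact: (pairing_cvg_cut_cvg uG wG (ltW c0) FI IM FM).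
rewrite compact_ultra => F UF FI; have [M IM FM] := lim F UF FI.
by exists M; split => //; exact: (cut_cvgP (P := P) M).2 FM.
Qed.
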